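(* Let $\mathcal W_2(n)$ be the set of $2$-stack-sortable permutations in $S_n$ and define $$J(t,u,v)=\sum_{n\geq 1}\sum_{\pi\in\mathcal W_2(n)}|s^{-1}(\pi)|\,t^n u^{\mathrm{leg}(\pi)-1}v^{\mathrm{tl}(\pi)}.$$ Let $C(x)=\frac{1-\sqrt{1-4x}}{2x}=\sum_{n\ge0}\frac{1}{n+1}\binom{2n}{n}x^n$. Then $$J(t,u,v)=(C(tuv)-1)\bigl(1+tu\,J(t,u,1)\bigr)+\frac{tuv}{1-u}\left(\frac{J(t,u,1)-J(t,u,v)}{1-v}-\frac{C(tuv)-1}{v}\right)\cdot\left(\frac{J(t,1,1)-uv\,J(t,1,uv)}{1-uv}-u\,\frac{J(t,u,1)-v\,J(t,u,v)}{1-v}\right).$$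
   Context: $S_n$ is the set of permutations of $\{1,\dots,n\}$. The stack-sorting map $s$ is defined recursively: $s$ sends the empty permutation to itself, and if $\pi$ is nonempty with largest entry $m$, written $\pi=LmR$, then $s(\pi)=s(L)\,s(R)\,m$; $s^{-1}(\pi)$ denotes the set of permutations $\sigma$ (of the same set of entries) with $s(\sigma)=\pi$. A permutation is $k$-stack-sortable if $s^k(\pi)$ is increasing. For $\pi=\pi_1\cdots\pi_n\in S_n$, the tail length $\mathrm{tl}(\pi)$ is the largest $\ell\in\{0,\dots,n\}$ such that $\pi_i=i$ for all $i\in\{n-\ell+1,\dots,n\}$. For $a\in\{0,\dots,n\}$, the open interval $(a,a+1)$ is a legal space for $\pi$ if there do not exist indices $i_1<i_2<i_3$ with $\pi_{i_3}\le a<\pi_{i_1}<\pi_{i_2}$; $\mathrm{leg}(\pi)$ is the number of legal spaces of $\pi$. The identity is one of formal power series in $t$ with coefficients polynomial in $u,v$ (the divided differences are exact). *)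

(* Defs.v *)
From HB Require Import structures.
From mathcomp Require Import all_boot all_order all_algebra fraction.
Set Implicit Arguments. Unset Strict Implicit. Unset Printing Implicit Defensive.
Import Order.TTheory GRing.Theory Num.Theory.

Definition Sn (n : nat) : seq (seq nat) := permutations (iota 1 n).

Definition maxentry (p : seq nat) : nat := foldr maxn 0 p.

(* stack-sorting map with fuel: s(L m R) = s(L) s(R) m *)
Fixpoint ssort_fuel (k : nat) (p : seq nat) : seq nat :=
  match k with
  | 0 => [::]
  | k'.+1 =>
      if p is [::] then [::] else
      let m := maxentry p in
      let i := index m p in
      ssort_fuel k' (take i p) ++ ssort_fuel k' (drop i.+1 p) ++ [:: m]
  end.

Definition ssort (p : seq nat) : seq nat := ssort_fuel (size p) p.

Definition npreimages (pi : seq nat) : nat :=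
  count (fun sigma => ssort sigma == pi) (Sn (size pi)).

Definition two_stack_sortable (pi : seq nat) : bool :=
  sorted ltn (ssort (ssort pi)).

Definition W2 (n : nat) : seq (seq nat) := [seq pi <- Sn n | two_stack_sortable pi].

(* tail length: largest l <= n with pi_i = i for all i in {n-l+1, ..., n}
   (entries are 1-indexed in the paper, nth is 0-indexed) *)
Definition tl (pi : seq nat) : nat :=
  let n := size pi in
  \max_(l < n.+1 | all (fun i => nth 0 pi i.-1 == i) (iota (n - l).+1 l)) (l : nat).

(* (a, a+1) is a legal space for pi: no indices i1 < i2 < i3 with
   pi_{i3} <= a < pi_{i1} < pi_{i2} *)
Definition legal_space (pi : seq nat) (a : nat) : bool :=
  let n := size pi in
  ~~ has (fun i1 => has (fun i2 => has (fun i3 =>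
        [&& i1 < i2, i2 < i3, nth 0 pi i3 <= a, a < nth 0 pi i1
          & nth 0 pi i1 < nth 0 pi i2])
      (iota 0 n)) (iota 0 n)) (iota 0 n).

Definition leg (pi : seq nat) : nat := count (legal_space pi) (iota 0 (size pi).+1).

(* ---------- Coefficient field: Q(u, v) realised as Frac(Z[u][v]) ---------- *)

Local Open Scope ring_scope.

(* bivariate integer polynomials: outer variable v, inner variable u *)
Definition Ruv := {poly {poly int}}.
Definition K := {fraction Ruv}.

Definition uK : K := @tofrac Ruv (('X : {poly int})%:P).
Definition vK : K := @tofrac Ruv 'X.

(* formal power series in t with coefficients in K, as coefficient sequences *)
Definition series := nat -> K.

Definition sadd (f g : series) : series := fun n => f n + g n.
Definition ssub (f g : series) : series := fun n => f n - g n.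
Definition sscale (c : K) (f : series) : series := fun n => c * f n.
Definition smul (f g : series) : series :=
  fun n => \sum_(i < n.+1) f i * g (n - i)%N.
Definition sone : series := fun n => if n == 0%N then 1 else 0.
Definition stimes_t (f : series) : series :=
  fun n => if n is k.+1 then f k else 0.

Definition J (a b : K) : series := fun n =>
  if n == 0%N then 0 else
  \sum_(pi <- W2 n) (npreimages pi)%:R * a ^+ (leg pi - 1) * b ^+ (tl pi).

(* C(t x) - 1 = sum_{n >= 1} 1/(n+1) binom(2n, n) x^n t^n *)
Definition Cm1 (x : K) : series := fun n =>
  if n == 0%N then 0 else ('C(n.*2, n))%:R / (n.+1)%:R * x ^+ n.

(* Main.v *)
(** Write a permutation of [1..n] that is not the identity as [A M B x_1 .. x_l],
    where [x_1 .. x_l] is its maximal tail of fixed points, [M = n - l] and [B] is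
    nonempty.  Splitting a preimage at its largest entry gives a recursion for the
    number [f] of preimages, from which
      [f (A M B x_1 .. x_l) = \sum_j f (A M x_(j+1) .. x_l) f (B x_1 .. x_(j-1))].
    The permutation is 2-stack-sortable iff [A] and [B] are, all entries of [A]
    except possibly its maximum lie below those of [B], and that maximum falls in a
    legal space [c] of [B].  If [c] is the [r]-th legal space of [B] from the top,
    then [leg] of the whole is [leg A + l + r].  Summing over [r] yields the factor
    [1/(1-u)], summing over the number of entries appended to [A] or [B] yields the
    divided differences in [v], and the identities, counted by the Catalan numbers,
    give the terms in [C(tuv) - 1]. *)
Require Import Defs.
From HB Require Import structures.
From mathcomp Require Import all_boot all_order all_algebra fraction.
From mathcomp Require Import zify ring.
From Stdlib Require Import FunctionalExtensionality.
Import GRing.Theory.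
Set Implicit Arguments. Unset Strict Implicit. Unset Printing Implicit Defensive.

(** * The stack-sorting map *)

(** The obstacle is that [f (A x_1 .. x_i)] is not determined by [f A], while the decomposition of
    [f] asks for it at every [i]. The variable [v] supplies these numbers: tail length at least [i]
    means that [i] entries have been appended, and [1 + v + .. + v^tl] is a quotient by [1-v]. An
    appended entry also opens one legal space, so it weighs [tuv] altogether. Legal spaces enter
    because an inversion of [s(B)] is the trace of a 231 pattern of [B]: the maximum of [A]
    completes a 231 pattern in [s(A) s(B)] exactly when it falls between the two values of such an
    inversion. Summing [u^r] over [r] from 1 to [leg B] gives [u (1 - u^(leg B)) / (1-u)]. The part
    coming from [1] no longer sees [leg B], but entries appended to [B] still carry [uv]; this is
    the origin of [J(t,1,1)] and [J(t,1,uv)]. An empty [A] has no maximum to place, so only the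
    lowest space is available. This case is kept apart throughout and yields products with
    [C(tuv) - 1]. *)

Lemma maxentry_ge p x : x \in p -> x <= maxentry p.
Proof.
elim: p => //= y p IH; rewrite inE => /orP[/eqP-> |/IH]; lia.
Qed.

Lemma maxentry_in p : p != [::] -> maxentry p \in p.
Proof.
elim: p => //= y [|z p] IH _; first by rewrite /= maxn0 inE.
have := IH isT; rewrite -/(maxentry _); set q := z :: p => qP.
by case: (leqP (maxentry q) y) => _; rewrite inE ?qP ?eqxx ?orbT.
Qed.

Lemma maxentry_mid L m R : {in L, forall x, x < m} -> {in R, forall x, x < m} ->
  maxentry (L ++ m :: R) = m.
Proof.
move=> hL hR; apply/eqP; rewrite eqn_leq maxentry_ge ?mem_cat ?inE ?eqxx ?orbT//.
rewrite andbT; have : maxentry (L ++ m :: R) \in L ++ m :: R.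
  by apply: maxentry_in; case: (L).
by rewrite mem_cat inE => /or3P[/hL/ltnW|/eqP->|/hR/ltnW].
Qed.

(** The split around the maximum is the recursion defining [s]; together with [ssort_mid] this
    induction replaces reasoning about fuel. *)
Lemma uniq_max_ind (P : seq nat -> Prop) : P [::] ->
  (forall L m R, uniq (L ++ m :: R) -> {in L, forall x, x < m} ->
    {in R, forall x, x < m} -> P L -> P R -> P (L ++ m :: R)) ->
  forall w, uniq w -> P w.
Proof.
move=> P0 PS w; have [n] := ubnP (size w); elim: n w => // n IH w lt_wn uw.
have [->//|w0] := eqVneq w [::].
have := maxentry_in w0; have := @maxentry_ge w.
move: (maxentry w) => m hm /splitPr mw; case: mw uw lt_wn hm => L R uw lt_wn hm.
have := uw; rewrite cat_uniq /= => /and3P[uL].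
rewrite negb_or => /andP[mL _] /andP[mR uR].
move: lt_wn; rewrite size_cat addnS ltnS => lt_wn.
apply: PS => //; [| |apply: IH => //|apply: IH => //]; last 2 first.
- by rewrite (leq_ltn_trans _ lt_wn) ?leq_addr.
- by rewrite (leq_ltn_trans _ lt_wn) ?leq_addl.
- move=> x xL; rewrite ltn_neqAle hm ?mem_cat ?xL// andbT.
  by apply: contraNneq mL => <-.
- move=> x xR; rewrite ltn_neqAle hm ?mem_cat ?inE ?xR ?orbT// andbT.
  by apply: contraNneq mR => <-.
Qed.

Lemma index_mid (T : eqType) (L R : seq T) m : m \notin L ->
  index m (L ++ m :: R) = size L.
Proof. by move=> mL; rewrite index_cat (negPf mL) /= eqxx addn0. Qed.

Lemma ssort_fuel_eq k k' p : size p <= k -> size p <= k' ->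
  ssort_fuel k p = ssort_fuel k' p.
Proof.
elim: k k' p => [|k IH] [|k'] [|x p] //= hk hk'.
set q := x :: p; set m := maxn x _.
have lt_iq : index m q < size q by rewrite index_mem; apply: (@maxentry_in q).
have hi : size (take (index m q) q) <= size p by rewrite size_take lt_iq.
have hd : size (drop (index m q) p) <= size p by rewrite size_drop leq_subr.
by congr (_ ++ (_ ++ _)); apply: IH; apply: leq_trans; eauto.
Qed.

Lemma ssort_mid L m R : {in L, forall x, x < m} -> {in R, forall x, x < m} ->
  ssort (L ++ m :: R) = ssort L ++ ssort R ++ [:: m].
Proof.
move=> hL hR; rewrite /ssort size_cat /= addnS /=.
have mL : m \notin L by apply/negP => /hL; rewrite ltnn.
case E: (L ++ m :: R) => [|x q]; first by case: (L) E.
rewrite -E -/(maxentry _) maxentry_mid// index_mid// take_size_cat//.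
rewrite drop_cat ltnNge leqnSn /= subSnn /= drop0.
by congr (_ ++ (_ ++ _)); apply: ssort_fuel_eq; rewrite ?leq_addr ?leq_addl.
Qed.

Lemma ssort_rcons w m : {in w, forall x, x < m} -> ssort (rcons w m) = rcons (ssort w) m.
Proof. by move=> hw; rewrite -cats1 ssort_mid ?cats1. Qed.

Lemma perm_ssort w : uniq w -> perm_eq (ssort w) w.
Proof.
move: w; apply: uniq_max_ind => // L m R _ hL hR PL PR.
by rewrite ssort_mid// perm_cat// perm_catC /= perm_cons.
Qed.

Lemma mem_ssort w : uniq w -> ssort w =i w.
Proof. by move/perm_ssort/perm_mem. Qed.

Lemma ssort_uniq w : uniq w -> uniq (ssort w).
Proof. by move=> uw; rewrite (perm_uniq (perm_ssort uw)). Qed.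

Lemma size_ssort w : uniq w -> size (ssort w) = size w.
Proof. by move/perm_ssort/perm_size. Qed.

Lemma ssort_cat_incr w t : sorted ltn t ->
  {in w & t, forall x y, x < y} -> ssort (w ++ t) = ssort w ++ t.
Proof.
elim/last_ind: t => [|t m IH] st hwt; first by rewrite !cats0.
have st' : sorted ltn t by move: st; rewrite -cats1; case/cat_sorted2.
rewrite -!rcons_cat ssort_rcons ?IH//.
  by move=> x y xw yt; apply: hwt; rewrite // mem_rcons inE yt orbT.
move=> x; rewrite mem_cat => /orP[xw|xt]; first by apply: hwt; rewrite // mem_rcons mem_head.
move: st; rewrite (sorted_pairwise ltn_trans) pairwise_rcons => /andP[/allP + _].
exact.
Qed.

Lemma ssort_map (g : nat -> nat) w : uniq w ->
  {in w &, {mono g : x y / x < y}} -> ssort (map g w) = map g (ssort w).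
Proof.
move: w; apply: uniq_max_ind => // L m R _ hL hR PL PR hg.
have mm : m \in L ++ m :: R by rewrite mem_cat mem_head orbT.
have sL x : x \in L -> x \in L ++ m :: R by rewrite mem_cat => ->.
have sR x : x \in R -> x \in L ++ m :: R by rewrite mem_cat inE => ->; rewrite !orbT.
rewrite map_cat /= ssort_mid; first last.
- by move=> _ /mapP[x xR ->]; rewrite hg// ?hR// sR.
- by move=> _ /mapP[x xL ->]; rewrite hg// ?hL// sL.
rewrite PL ?PR ?ssort_mid ?map_cat//; last by move=> x y /sL ? /sL; apply: hg.
by move=> x y /sR ? /sR; apply: hg.
Qed.

(** * Pattern avoidance *)

Lemma subseq2_cat (x y : nat) w1 w2 : subseq [:: x; y] (w1 ++ w2) =
  [|| subseq [:: x; y] w1, (x \in w1) && (y \in w2) | subseq [:: x; y] w2].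
Proof.
elim: w1 => [|a w1 IH] //; rewrite cat_cons.
have E w : subseq [:: x; y] (a :: w) = if x == a then y \in w else subseq [:: x; y] w.
  by rewrite -sub1seq /=; case: eqP.
rewrite !E IH inE; case: eqP => //= _; rewrite mem_cat; congr (_ || _).
case: (boolP (y \in w2)) => //= yw; apply/esym/negbTE; apply: contra yw => /mem_subseq.
by apply; rewrite !inE eqxx orbT.
Qed.

Lemma subseq3_cat (x z y : nat) w1 w2 : subseq [:: x; z; y] (w1 ++ w2) =
  [|| subseq [:: x; z; y] w1, subseq [:: x; z] w1 && (y \in w2),
      (x \in w1) && subseq [:: z; y] w2 | subseq [:: x; z; y] w2].
Proof.
elim: w1 => [|a w1 IH] //; rewrite cat_cons.
have E w : subseq [:: x; z; y] (a :: w) =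
    if x == a then subseq [:: z; y] w else subseq [:: x; z; y] w.
  by rewrite /=; case: eqP.
have E2 w : subseq [:: x; z] (a :: w) = if x == a then z \in w else subseq [:: x; z] w.
  by rewrite -sub1seq /=; case: eqP.
rewrite !E E2 IH inE; case: eqP => //= _; rewrite subseq2_cat; congr [|| _, _ | _].
case: (boolP (subseq _ w2)) => //= yw; apply/esym/negbTE; apply: contra yw.
by apply: subseq_trans; apply: suffix_subseq [:: x] _.
Qed.

Lemma subseq_cons_neq (x m : nat) s w : x != m ->
  subseq (x :: s) (m :: w) = subseq (x :: s) w.
Proof. by move=> /= /negPf->. Qed.

Lemma subseq_mapl (T1 T2 : eqType) (g : T1 -> T2) s w : subseq s (map g w) ->
  exists2 s', subseq s' w & s = map g s'.
Proof.
by case/subseqP => m sm ->; exists (mask m w); rewrite ?mask_subseq// map_mask.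
Qed.

Lemma mem_subseq2 (x y : nat) w : subseq [:: x; y] w -> x \in w /\ y \in w.
Proof. by move/mem_subseq => h; split; apply: h; rewrite !inE eqxx ?orbT. Qed.

Lemma mem_subseq3 (x z y : nat) w : subseq [:: x; z; y] w ->
  [/\ x \in w, z \in w & y \in w].
Proof. by move/mem_subseq => h; split; apply: h; rewrite !inE eqxx ?orbT. Qed.

(** Knuth's stack criterion: [x] leaves the stack ahead of a smaller [y] only if a larger [z]
    arrives between them and forces it out. *)
Lemma subseq2_ssort w x y : uniq w -> y < x ->
  reflect (exists2 z, x < z & subseq [:: x; z; y] w) (subseq [:: x; y] (ssort w)).
Proof.
move=> uw ltyx; apply: (iffP idP); move: w uw.
- apply: uniq_max_ind => // L m R uw hL hR IHL IHR; rewrite ssort_mid//.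
  have := uw; rewrite cat_uniq /= => /and3P[uL _ /andP[mR uR]].
  rewrite !subseq2_cat => /or3P[/IHL[z xz s]|/andP[]|/or3P[/IHR[z xz s]|/andP[]|]].
  + by exists z => //; rewrite subseq3_cat s.
  + rewrite mem_ssort// => xL; rewrite mem_cat mem_ssort// inE => /orP[yR|/eqP ym].
      exists m; first exact: hL.
      by rewrite subseq3_cat xL /= eqxx sub1seq yR !orbT.
    by have := hL _ xL; rewrite -ym ltnNge (ltnW ltyx).
  + by exists z => //; rewrite subseq3_cat (subseq_trans s (subseq_cons _ _)) !orbT.
  + rewrite mem_ssort// => /hR + /[!inE] /eqP ym; rewrite -ym ltnNge ltnW//.
  + by move/size_subseq.
- apply: uniq_max_ind => [[z _]|L m R uw hL hR IHL IHR [z xz]]; first by [].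
  have := uw; rewrite cat_uniq /= => /and3P[uL _ /andP[mR uR]].
  have xm : x \in L ++ m :: R -> x <= m.
    by rewrite mem_cat inE => /or3P[/hL/ltnW|/eqP->|/hR/ltnW].
  move=> s; rewrite ssort_mid// !subseq2_cat !mem_cat !mem_ssort//.
  have [xw zw yw] := mem_subseq3 s.
  have zm : z <= m by move: zw; rewrite mem_cat inE => /or3P[/hL/ltnW|/eqP->|/hR/ltnW].
  have {zm} xm' : x != m by rewrite neq_ltn (leq_trans xz).
  have ym' : y != m by rewrite neq_ltn (ltn_trans ltyx)// ltn_neqAle xm' xm.
  move: s; rewrite subseq3_cat => /or4P[s|/andP[s]|/andP[xL h]|].
  + by rewrite IHL//; exists z.
  + by have [-> _] := mem_subseq2 s; rewrite inE (negPf ym') /= => ->; rewrite !orbT.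
  + suff -> : y \in R by rewrite xL !orbT.
    move: h; case: (eqVneq z m) => [->|zm]; first by rewrite /= eqxx sub1seq.
    by rewrite subseq_cons_neq// => /mem_subseq2[].
  + rewrite subseq_cons_neq// => s; rewrite IHR ?orbT//; by exists z.
Qed.

Lemma sorted_ltnP w : uniq w ->
  reflect (forall x y, y < x -> ~~ subseq [:: x; y] w) (sorted ltn w).
Proof.
move=> uw; apply: (iffP idP) => [sw x y yx|].
  apply/negP => /(subseq_sorted ltn_trans)/(_ sw) /=.
  by rewrite andbT ltnNge ltnW.
elim: w uw => //= a w IH /andP[aw uw] h.
rewrite (path_sortedE ltn_trans) IH ?andbT//; last first.
  move=> x y /h; case: eqVneq => // ->.
  by rewrite sub1seq => ya; apply/negP => /mem_subseq2[]; rewrite (negPf aw).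
apply/allP => y yw; rewrite /= ltn_neqAle; apply/andP; split.
  by apply: contraNneq aw => ->.
by rewrite leqNgt; apply/negP => /h; rewrite eqxx sub1seq yw.
Qed.

Definition avoids231 (w : seq nat) :=
  forall x z y, y < x -> x < z -> ~~ subseq [:: x; z; y] w.

(** Knuth's theorem. Applied to [ssort w] in place of [w], it turns 2-stack-sortability into a
    condition on a single image under [s]. *)
Lemma sorted_ssortP w : uniq w -> reflect (avoids231 w) (sorted ltn (ssort w)).
Proof.
move=> uw; apply: (iffP (sorted_ltnP (ssort_uniq uw))) => h x.
  move=> z y yx xz; apply/negP => s; move: (h x y yx) => /negP; apply.
  by apply/(subseq2_ssort _ yx) => //; exists z.
by move=> y yx; apply/negP => /(subseq2_ssort uw yx)[z xz]; apply/negP/h.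
Qed.

(** * Counting preimages *)

Definition preimages (w : seq nat) : seq (seq nat) :=
  [seq s <- permutations w | ssort s == w].

Definition fertility (w : seq nat) : nat := size (preimages w).

Lemma mem_preimages w s : (s \in preimages w) = (ssort s == w) && perm_eq s w.
Proof. by rewrite mem_filter mem_permutations. Qed.

Lemma npreimagesE n w : w \in Sn n -> npreimages w = fertility w.
Proof.
rewrite mem_permutations => pw; rewrite /npreimages /fertility size_filter.
rewrite (perm_size pw) size_iota; apply/permP.
by rewrite perm_sym; apply: perm_permutations.
Qed.

Lemma ssort_rcons_max s w m : uniq s -> ssort s = rcons w m ->
  {in s, forall x, x <= m}.
Proof.
move: s; apply: uniq_max_ind => // L k R _ hL hR _ _.
rewrite ssort_mid// catA cats1 => /rcons_inj[_ <-] x.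
by rewrite mem_cat inE => /or3P[/hL/ltnW|/eqP->|/hR/ltnW].
Qed.

(** Every nonempty image of [s] ends in its maximum. *)
Lemma fertility_nmax w x m : uniq (rcons w m) -> x \in w -> m < x ->
  fertility (rcons w m) = 0.
Proof.
rewrite /fertility => uw xw mx; case E: preimages => [|s l] //.
have : s \in preimages (rcons w m) by rewrite E mem_head.
rewrite mem_preimages => /andP[/eqP ss ps].
have us : uniq s by rewrite (perm_uniq ps).
have := ssort_rcons_max us ss (x := x).
by rewrite (perm_mem ps) mem_rcons inE xw orbT leqNgt mx => /(_ isT).
Qed.

(** A preimage is [L m R] with [s(L) s(R) = w]. Once the cut [i], the length of [L], is chosen, [L]
    and [R] vary independently. *)
Lemma fertility_rcons w m : uniq w -> {in w, forall x, x < m} ->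
  fertility (rcons w m) =
  \sum_(0 <= i < (size w).+1) fertility (take i w) * fertility (drop i w).
Proof.
move=> uw hw.
have mw : m \notin w by apply/negP => /hw; rewrite ltnn.
pose T i := [seq (L, R) | L <- preimages (take i w), R <- preimages (drop i w)].
pose B := [seq LR.1 ++ m :: LR.2 | i <- iota 0 (size w).+1, LR <- T i].
have memT i LR : (LR \in T i) = (LR.1 \in preimages (take i w)) && (LR.2 \in preimages (drop i w)).
  case: LR => L R; apply/allpairsP/andP => [[[a b] /= [? ? [-> ->]]]//|[? ?]].
  by exists (L, R).
have szT i LR : i <= size w -> LR \in T i -> size LR.1 = i.
  rewrite memT !mem_preimages => iw /andP[/andP[_ /perm_size->] _].
  by rewrite size_takel.
have mT i LR : LR \in T i -> m \notin LR.1.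
  rewrite memT !mem_preimages => /andP[/andP[_ /perm_mem->] _].
  by apply: contra mw; apply: mem_take.
have : perm_eq (preimages (rcons w m)) B.
  apply: uniq_perm; first by rewrite filter_uniq ?permutations_uniq.
    apply: allpairs_uniq_dep; first exact: iota_uniq.
      by move=> i _; apply: allpairs_uniq => [||[? ?] [? ?] _ _ [-> ->]//];
         rewrite filter_uniq ?permutations_uniq.
    move=> p q /allpairsPdep[i [LR [/[!mem_iota] hi hLR {p}->]]].
    move=> /allpairsPdep[j [LR' [/[!mem_iota] hj hLR' ->]]] /= E.
    (* The position of [m] in the assembled word recovers the cut. *)
    have Ei := szT _ _ hi hLR; have Ej := szT _ _ hj hLR'.
    have Eij : i = j.
      by rewrite -Ei -Ej -(index_mid (LR.2) (mT _ _ hLR)) E index_mid ?(mT _ _ hLR').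
    have [E1 E2] : LR.1 = LR'.1 /\ LR.2 = LR'.2.
      split; first by rewrite -(take_size_cat (m :: LR.2) Ei) E Eij take_size_cat.
      suff : m :: LR.2 = m :: LR'.2 by case.
      by rewrite -(drop_size_cat (m :: LR.2) Ei) E Eij drop_size_cat.
    by case: LR LR' E1 E2 {hLR hLR' E Ei Ej} => [? ?] [? ?] /= -> ->; rewrite Eij.
  move=> s; rewrite mem_preimages; apply/andP/allpairsPdep; last first.
    move=> [i [[L R] [/[!mem_iota] hi /[!memT] /= /andP[]]]].
    rewrite !mem_preimages => /andP[/eqP sL pL] /andP[/eqP sR pR] ->.
    rewrite ssort_mid; first last.
    - by move=> x; rewrite (perm_mem pR) => /mem_drop /hw.
    - by move=> x; rewrite (perm_mem pL) => /mem_take /hw.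
    rewrite sL sR catA cat_take_drop cats1 eqxx; split=> //.
    rewrite -cat1s perm_catCA cat1s perm_sym perm_rcons perm_cons.
    by rewrite -[X in perm_eq X](cat_take_drop i w) perm_sym perm_cat.
  move=> [/eqP + ps].
  have us : uniq s by rewrite (perm_uniq ps) rcons_uniq mw.
  have : m \in s by rewrite (perm_mem ps) mem_rcons mem_head.
  move=> /splitPr sp; case: sp ps us => L R ps us.
  have us' := us; move: us'; rewrite cat_uniq /= => /and3P[uL].
  rewrite negb_or => /andP[mL _] /andP[mR uR].
  have hLR : {in L ++ R, forall x, x < m}.
    move=> x xLR; have : x \in L ++ m :: R.
      by move: xLR; rewrite !mem_cat inE => /orP[]->; rewrite ?orbT.
    rewrite (perm_mem ps) mem_rcons inE => /orP[/eqP E|/hw//].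
    by move: xLR; rewrite E mem_cat (negPf mL) (negPf mR).
  rewrite ssort_mid; first last.
  - by move=> x xR; rewrite hLR// mem_cat xR orbT.
  - by move=> x xL; rewrite hLR// mem_cat xL.
  rewrite catA cats1 => /rcons_inj[E].
  have szw : size L + size R = size w by rewrite -E size_cat !size_ssort.
  exists (size L), (L, R); split => //; first by rewrite -[_ :: _]/(iota 0 (size w).+1) mem_iota ltnS -szw leq_addr.
  rewrite memT !mem_preimages /= -E take_size_cat ?size_ssort//.
  by rewrite drop_size_cat ?size_ssort// !eqxx /= !(perm_sym _ (ssort _)) !perm_ssort.
move/perm_size; rewrite /fertility => ->.
rewrite size_allpairs_dep sumnE big_map /index_iota subn0.
by apply: eq_bigr => i _; rewrite size_allpairs.
Qed.

Lemma fertility_rcons_if w m : uniq (rcons w m) -> fertility (rcons w m) =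
  if all (fun x => x < m) w then
    \sum_(0 <= i < (size w).+1) fertility (take i w) * fertility (drop i w)
  else 0.
Proof.
move=> uwm; have := uwm; rewrite rcons_uniq => /andP[mw uw].
case: allP => [/fertility_rcons->//|/allP/allPn[x xw]]; rewrite -leqNgt => mx.
apply: (fertility_nmax uwm xw); rewrite ltn_neqAle mx andbT.
by apply: contraNneq mw => ->.
Qed.

Lemma fertility_map (g : nat -> nat) w : uniq w ->
  {in w &, {mono g : x y / x < y}} -> fertility (map g w) = fertility w.
Proof.
have [n] := ubnP (size w); elim: n w => // n IH w.
case/lastP: w => [//|w m]; rewrite size_rcons ltnS => szw uwm gm.
have ug : uniq (map g (rcons w m)).
  rewrite map_inj_in_uniq// => x y xw yw gxy; have := gm x y xw yw; have := gm y x yw xw.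
  by rewrite gxy ltnn; lia.
move: ug; rewrite map_rcons => ug.
rewrite !fertility_rcons_if// all_map size_map.
have -> : all (preim g (fun x => x < g m)) w = all (fun x => x < m) w.
  by apply: eq_in_all => x xw; rewrite /= gm// mem_rcons inE ?xw ?eqxx ?orbT.
case: ifP => // _; apply: eq_big_nat => i /andP[_ iw].
move: uwm; rewrite rcons_uniq => /andP[_ uw].
have sw : {subset w <= rcons w m} by move=> x; rewrite mem_rcons inE orbC => ->.
rewrite -map_take -map_drop; congr (_ * _); apply: IH.
- by rewrite size_takel// (leq_trans iw).
- exact: take_uniq.
- by move=> x y /mem_take/sw ? /mem_take/sw; apply: gm.
- by rewrite size_drop (leq_ltn_trans (leq_subr _ _)).
- exact: drop_uniq.
- by move=> x y /mem_drop/sw ? /mem_drop/sw; apply: gm.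
Qed.

(** Normal form of a block with its tail: only relative order matters, so an increasing tail above
    the block may be replaced by consecutive values. *)
Lemma fertility_ext (g : nat -> nat) w k t : uniq w -> {in w, forall x, x < k} ->
  {in w &, {mono g : x y / x < y}} -> sorted ltn t ->
  {in w & t, forall x y, g x < y} ->
  fertility (map g w ++ t) = fertility (w ++ iota k (size t)).
Proof.
move=> uw wk gm st gt; pose h x := if x < k then g x else nth 0 t (x - k).
have -> : map g w ++ t = map h (w ++ iota k (size t)).
  rewrite map_cat; congr (_ ++ _).
    by apply/eq_in_map => x /wk; rewrite /h => ->.
  apply: (@eq_from_nth _ 0) => [|i it]; first by rewrite size_map size_iota.
  by rewrite (nth_map 0) ?size_iota// nth_iota// /h ltnNge leq_addr addKn.
apply: fertility_map => [|x y].
  rewrite cat_uniq uw iota_uniq andbT; apply/hasPn => x; rewrite mem_iota => /andP[kx _].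
  by apply/negP => /wk; rewrite ltnNge kx.
have ltnth i j : i < size t -> j < size t -> (nth 0 t i < nth 0 t j) = (i < j).
  move=> it jt; have H := sorted_ltn_nth ltn_trans 0 st.
  case: (ltngtP i j) => [ij|ji|->]; last by rewrite ltnn.
    exact: H.
  by apply/negbTE; rewrite -leqNgt ltnW//; apply: H.
rewrite !mem_cat !mem_iota /h => /orP[xw|xt] /orP[yw|yt].
- by rewrite !wk// gm.
- have [yk ys xy] : [/\ (y < k) = false, y - k < size t & x < y].
    by have := wk x xw; split; lia.
  by rewrite wk// yk xy; apply: gt => //; apply: mem_nth.
- have [xk xs xy] : [/\ (x < k) = false, x - k < size t & (x < y) = false].
    by have := wk y yw; split; lia.
  rewrite (wk y yw) xk xy.
  by apply/negbTE; rewrite -leqNgt ltnW//; apply: gt => //; apply: mem_nth.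
- have [xk xs yk ys] : [/\ (x < k) = false, x - k < size t, (y < k) = false & y - k < size t].
    by split; lia.
  by rewrite xk yk ltnth//; lia.
Qed.

(** * Decomposition of fertility at the largest entry outside the tail *)

Lemma big_splits_cat (G : seq nat -> seq nat -> nat) A M V :
  \sum_(0 <= i < (size (A ++ M :: V)).+1) G (take i (A ++ M :: V)) (drop i (A ++ M :: V)) =
  \sum_(0 <= i < (size A).+1) G (take i A) (drop i A ++ M :: V) +
  \sum_(0 <= i < (size V).+1) G (A ++ M :: take i V) (drop i V).
Proof.
rewrite (@big_cat_nat _ _ _ (size A).+1) //=; last by rewrite size_cat; lia.
congr (_ + _).
  apply: eq_big_nat => i /andP[_ iA]; rewrite take_cat drop_cat.
  case: ltngtP => [//|?|->]; first by lia.
  by rewrite subnn take0 drop0 cats0 take_size drop_size.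
rewrite -[X in \sum_(X <= _ < _) _]add0n big_addn.
have -> : (size (A ++ M :: V)).+1 - (size A).+1 = (size V).+1 by rewrite size_cat /=; lia.
apply: eq_bigr => i _; rewrite take_cat drop_cat; have -> : i + (size A).+1 < size A = false by lia.
by have -> : i + (size A).+1 - size A = i.+1 by lia.
Qed.

Lemma big_triangle (R : Type) (idx : R) (op : Monoid.com_law idx) t (g : nat -> nat -> R) :
  \big[op/idx]_(0 <= k < t) \big[op/idx]_(0 <= j < k.+1) g j k =
  \big[op/idx]_(0 <= j < t) \big[op/idx]_(0 <= i < t - j) g j (j + i).
Proof.
elim: t => [|t IH]; first by rewrite !big_geq.
rewrite big_nat_recr//= IH [RHS]big_nat_recr//= subSn// subnn big_nat1 addn0.
under [in RHS]eq_big_nat => j /andP[_ jt].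
  rewrite subSn ?(ltnW jt)// big_nat_recr//= subnKC ?(ltnW jt)//.
  over.
by rewrite big_split/= [X in op _ X]big_nat_recr//= Monoid.mulmA.
Qed.

(** A piece [A M B] without larger entries behind it has no preimage, so splitting at successive
    maxima must at some point cut just behind [M]. The tail entry at which this happens is missing
    from both factors; [j] entries of [T] precede it and stay with [B], the later ones go with
    [A M]. *)
Lemma fertility_decomp A M B T : B != [::] -> uniq (A ++ M :: B ++ T) ->
  {in A, forall x, x < M} -> {in B, forall x, x < M} -> sorted ltn (M :: T) ->
  fertility (A ++ M :: B ++ T) =
  \sum_(0 <= j < size T) fertility (A ++ M :: drop j.+1 T) * fertility (B ++ take j T).
Proof.
have [n] := ubnP (size T); elim: n A T => // n IH A T; case/lastP: T.
  (* Without a tail the word ends in an entry of [B], which is below [M]. *)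
  move=> _ B0 u hA hB _; rewrite big_nil cats0.
  case/lastP: B B0 u hB {IH} => // B b _ + hB; rewrite cats0 -rcons_cons -rcons_cat => u.
  apply: (fertility_nmax (x := M)) => //; first by rewrite mem_cat mem_head orbT.
  by apply: hB; rewrite mem_rcons mem_head.
move=> T x; rewrite size_rcons ltnS => szT B0 u hA hB /= sT.
have sMx : sorted ltn (rcons (M :: T) x) by [].
have sT' : sorted ltn (M :: T) by move: sMx; rewrite -cats1 => /cat_sorted2[].
have hx : {in M :: T, forall y, y < x}.
  by move: sMx; rewrite (sorted_pairwise ltn_trans) pairwise_rcons => /andP[/allP].
have Mx : M < x by apply: hx; rewrite mem_head.
have u' : uniq (rcons (A ++ M :: B ++ T) x) by rewrite rcons_cat rcons_cons rcons_cat.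
have hAB : {in A ++ M :: B ++ T, forall y, y < x}.
  move=> y; rewrite mem_cat inE mem_cat => /or4P[/hA yM|/eqP->//|/hB yM|yT].
  - exact: ltn_trans Mx.
  - exact: ltn_trans Mx.
  - by apply: hx; rewrite inE yT orbT.
have [xn uw] : x \notin A ++ M :: B ++ T /\ uniq (A ++ M :: B ++ T).
  by move: u'; rewrite rcons_uniq => /andP[].
rewrite -rcons_cat -rcons_cons -rcons_cat fertility_rcons//.
rewrite (big_splits_cat (fun l r => fertility l * fertility r)).
set lhs1 := (X in X + _ = _); set lhs2 := (X in _ + X = _).
(* The summand that skips the new maximum [x] itself is set aside; it matches the cut just behind
   [M]. In the other summands [x] ends the left factor, which is expanded by its own cuts. *)
rewrite big_nat_recr//= drop_oversize ?size_rcons//.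
rewrite -cats1 take_size_cat// cats1.
under [X in _ = X + _]eq_big_nat => j /andP[_ jT].
  have -> : take j (rcons T x) = take j T by rewrite -cats1 take_cat jT.
  rewrite drop_rcons// -rcons_cons -rcons_cat fertility_rcons; first last.
  - move=> y hy; apply: hAB; move: hy; rewrite !mem_cat !inE mem_cat.
    by case/or3P=> [->|->|/mem_drop->]; rewrite ?orbT.
  - apply: subseq_uniq uw; apply: cat_subseq => //=; rewrite eqxx.
    by rewrite -[drop _ _]cat0s; apply: cat_subseq; [exact: sub0seq | exact: drop_subseq].
  rewrite (big_splits_cat (fun l r => fertility l * fertility r)) mulnDl.
  over.
rewrite big_split /= -addnA; congr (_ + _).
  (* Cuts inside [A]: the right-hand piece still contains [M B T], so the induction hypothesis
     applies to it. *)
  under [RHS]eq_bigr => j _ do rewrite big_distrl /=.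
  rewrite exchange_big_nat /= /lhs1; apply: eq_big_nat => i _.
  rewrite IH//; last first.
  - by move=> y /mem_drop/hA.
  - move: uw; rewrite -{1}(cat_take_drop i A) -catA cat_uniq => /and3P[] //.
  by rewrite big_distrr /=; apply: eq_bigr => j _; rewrite mulnA.
rewrite /lhs2 big_ltn// take0 drop0 addnC; congr (_ + _).
have szB : 0 < size B by rewrite lt0n size_eq0.
rewrite (@big_cat_nat _ _ _ (size B).+1) //=; last by rewrite size_cat; lia.
(* Cuts inside [B] or at its end contribute nothing: the left piece ends below its entry [M]. *)
rewrite big_nat_cond big1 ?add0n; last first.
  move=> i /andP[/andP[i0 iB] _]; rewrite take_cat.
  have -> : (if i < size B then take i B else B ++ take (i - size B) T) = take i B.
    case: ltnP => // Bi; have -> : i = size B by apply/eqP; rewrite eqn_leq -ltnS iB.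
    by rewrite subnn take0 take_size cats0.
  suff -> : fertility (A ++ M :: take i B) = 0 by [].
  have : uniq (A ++ M :: take i B).
    apply: subseq_uniq uw; apply: cat_subseq => //=; rewrite eqxx.
    by rewrite -[take _ _]cats0; apply: cat_subseq; [exact: take_subseq | exact: sub0seq].
  have : {in take i B, forall y, y < M} by move=> y /mem_take/hB.
  have : size (take i B) != 0 by rewrite size_takel -?lt0n.
  case/lastP: (take i B) => // C c _ hC; rewrite -rcons_cons -rcons_cat => uC.
  apply: (fertility_nmax (x := M)) => //; first by rewrite mem_cat mem_head orbT.
  by apply: hC; rewrite mem_rcons mem_head.
rewrite -[X in \sum_(X <= _ < _) _]add0n big_addn.
have -> : (size (B ++ T)).+1 - (size B).+1 = size T by rewrite size_cat; lia.
(* Cuts behind [k + 1] entries of [T]: the induction hypothesis splits the left piece, and the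
   triangular double sum is then reordered. *)
transitivity (\sum_(0 <= k < size T) \sum_(0 <= j < k.+1)
  fertility (A ++ M :: drop j.+1 (take k.+1 T)) * fertility (B ++ take j T)
    * fertility (drop k.+1 T)).
  apply: eq_big_nat => k /andP[_ kT].
  rewrite take_cat drop_cat; have -> : k + (size B).+1 < size B = false by lia.
  have -> : k + (size B).+1 - size B = k.+1 by lia.
  rewrite IH// ?size_takel//; first last.
  - by rewrite -[_ :: _]/(take k.+2 (M :: T)); apply: subseq_sorted sT'; [exact: ltn_trans | exact: take_subseq].
  - apply: subseq_uniq uw; apply: cat_subseq => //=; rewrite eqxx.
    by apply: cat_subseq => //; exact: take_subseq.
  - by apply: leq_trans szT.
  rewrite big_distrl /=; apply: eq_big_nat => j /andP[_ jk].
  by rewrite take_takel // ltnW.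
rewrite (big_triangle _ _ (fun j k => fertility (A ++ M :: drop j.+1 (take k.+1 T))
  * fertility (B ++ take j T) * fertility (drop k.+1 T))) /=.
apply: eq_big_nat => j /andP[_ jT]; rewrite big_distrl /=.
rewrite size_drop subnSK//.
apply: eq_bigr => i _; rewrite take_drop drop_drop.
by have -> : i + j.+1 = (j + i).+1; [lia | rewrite mulnAC].
Qed.

(** * Catalan numbers *)

(** The number of stack-sortable permutations; the recursion at the maximum becomes the Catalan
    convolution. *)
Definition catalan n := fertility (iota 1 n).

Lemma catalan0 : catalan 0 = 1. Proof. by []. Qed.

Lemma catalanS n : catalan n.+1 = \sum_(0 <= i < n.+1) catalan i * catalan (n - i).
Proof.
rewrite /catalan -[n.+1 in LHS]addn1 iotaD add1n cats1 fertility_rcons ?iota_uniq//; last first.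
  by move=> x; rewrite mem_iota add1n ltnS => /andP[].
rewrite size_iota; apply: eq_big_nat => i /andP[_ iltn].
rewrite take_iota drop_iota (minn_idPl _)//; congr (_ * _).
have -> : iota (1 + i) (n - i) = map (addn i) (iota 1 (n - i)) by rewrite -iotaDl addnC.
apply: fertility_map; first exact: iota_uniq.
by move=> x y _ _; rewrite ltn_add2l.
Qed.

Lemma catalan_convE n : 2 * (\sum_(0 <= i < n.+1) i.+1 * (catalan i * catalan (n - i)))
  = n.+2 * catalan n.+1.
Proof.
rewrite catalanS mul2n -addnn [X in _ + X = _]big_nat_rev /= add0n -big_split big_distrr /=.
apply: eq_big_nat => i /andP[_ iltn]; rewrite subSS subKn//.
by rewrite [catalan (n - i) * _]mulnC -mulnDl; congr (_ * _); lia.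
Qed.

(* Doubling turns a factor [i.+1] under the convolution into the constant
   [n.+2], by the symmetry [i <-> n - i]. *)
Lemma catalan_rec n : n.+2 * catalan n.+1 = (4 * n + 2) * catalan n.
Proof.
elim/ltn_ind: n => -[|n] IH //.
rewrite -catalan_convE big_nat_recl//= subn0 catalan0 !mul1n.
set X := (X in _ * (_ + X) = _).
have : X + 2 * catalan n.+1 =
    4 * \sum_(0 <= i < n.+1) i.+1 * (catalan i * catalan (n - i)).
  rewrite catalanS !big_distrr -big_split /=; apply: eq_big_nat => i /andP[_ iltn].
  by rewrite subSS mulnA IH//; lia.
by have := catalan_convE n; lia.
Qed.

Lemma catalanE n : n.+1 * catalan n = 'C(n.*2, n).
Proof.
elim: n => [//|n IH].
apply/eqP; rewrite -(eqn_pmul2l (ltn0Sn n)) catalan_rec mulnCA IH.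
have E1 := mul_bin_diag n.+1.*2 n; have E2 := mul_bin_diag n.*2.+1 n.
have E3 : 'C(n.*2.+1, n) = 'C(n.*2.+1, n.+1).
  rewrite -[LHS]bin_sub; last lia.
  congr 'C(_, _); lia.
by apply/eqP; move: E1 E2; rewrite doubleS /= E3; lia.
Qed.

(** * Legal spaces and tails *)

Lemma subseq2_nth (x y : nat) w : subseq [:: x; y] w ->
  exists i j, [/\ i < j, j < size w, nth 0 w i = x & nth 0 w j = y].
Proof.
elim: w => // a w IH; rewrite -[subseq _ _]/(subseq (if x == a then [:: y] else [:: x; y]) w).
case: eqP => [->|_].
  rewrite sub1seq => yw; exists 0, (index y w).+1.
  by split; rewrite /= ?nth_index ?ltnS ?index_mem.
by case/IH => i [j [ij jw hi hj]]; exists i.+1, j.+1; rewrite ltnS.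
Qed.

Lemma subseq3_nth (x z y : nat) w : subseq [:: x; z; y] w ->
  exists i j k, [/\ i < j, j < k, k < size w &
                 [/\ nth 0 w i = x, nth 0 w j = z & nth 0 w k = y]].
Proof.
elim: w => // a w IH.
rewrite -[subseq _ _]/(subseq (if x == a then [:: z; y] else [:: x; z; y]) w).
case: eqP => [->|_].
  by case/subseq2_nth => i [j [ij jw hi hj]]; exists 0, i.+1, j.+1; rewrite !ltnS.
by case/IH => i [j [k [ij jk kw hh]]]; exists i.+1, j.+1, k.+1; rewrite !ltnS.
Qed.

Lemma nth_subseq3 w i j k : i < j -> j < k -> k < size w ->
  subseq [:: nth 0 w i; nth 0 w j; nth 0 w k] w.
Proof.
move=> ij jk kw; have jw := ltn_trans jk kw.
rewrite -{4}(cat_take_drop j w) subseq3_cat (drop_nth 0 jw) [_ && subseq _ _]andbC.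
have -> : nth 0 w i \in take j w.
  by rewrite -(nth_take 0 ij) mem_nth// size_take jw.
rewrite /= eqxx sub1seq.
have -> : nth 0 w k \in drop j.+1 w; last by rewrite !orbT.
by rewrite -(subnKC jk) -nth_drop mem_nth// size_drop ltn_sub2r// (leq_ltn_trans jk kw).
Qed.

Lemma legal_spaceP w a :
  reflect (forall x z y, y <= a -> a < x -> x < z -> ~~ subseq [:: x; z; y] w)
          (legal_space w a).
Proof.
apply: (iffP idP) => [h x z y ya ax xz|h].
  apply/negP => /subseq3_nth[i [j [k [ij jk kw [hi hj hk]]]]].
  move/negP: h; apply; have jw := ltn_trans jk kw.
  have iw := ltn_trans ij jw.
  apply/hasP; exists i; first by rewrite mem_iota.
  apply/hasP; exists j; first by rewrite mem_iota.
  apply/hasP; exists k; first by rewrite mem_iota.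
  by rewrite ij jk hi hj hk ya ax xz.
apply/hasP => -[i _ /hasP[j _ /hasP[k]]]; rewrite mem_iota => kw.
case/and5P => ij jk ya ax xz; move: (h _ _ _ ya ax xz).
by rewrite nth_subseq3.
Qed.

Lemma tail_fixedE w l : l <= size w ->
  all (fun i => nth 0 w i.-1 == i) (iota (size w - l).+1 l) =
  (drop (size w - l) w == iota (size w - l).+1 l).
Proof.
move=> lw; apply/allP/eqP => [h|E i].
  have sz : size (drop (size w - l) w) = l by rewrite size_drop subKn.
  apply: (@eq_from_nth _ 0) => [|i]; rewrite ?size_iota// sz => il.
  rewrite nth_drop nth_iota//; apply/eqP.
  have := h ((size w - l).+1 + i); rewrite addSn /=; apply.
  by rewrite mem_iota -addSn leq_addr ltn_add2l.
rewrite mem_iota => /andP[h1 h2]; apply/eqP.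
have -> : i.-1 = size w - l + (i.-1 - (size w - l)) by lia.
by rewrite -nth_drop E nth_iota; lia.
Qed.

(** Fixed tails are nested, so the maximum reduces to a threshold test. *)
Lemma leq_tl w i : i <= size w ->
  (i <= tl w) = (drop (size w - i) w == iota (size w - i).+1 i).
Proof.
move=> iw; apply/idP/idP => [|E]; last first.
  have iw' : i < (size w).+1 by [].
  apply: (@leq_bigmax_cond _ _ (fun l : 'I_(size w).+1 => (l : nat)) (Ordinal iw')).
  by rewrite tail_fixedE.
(* The tail of length zero always qualifies, hence the maximum is attained. *)
have : 0 < #|[pred l : 'I_(size w).+1 |
    all (fun i => nth 0 w i.-1 == i) (iota (size w - l).+1 l)]|.
  by apply/card_gt0P; exists ord0; rewrite inE.
case/(eq_bigmax_cond (fun l : 'I_(size w).+1 => (l : nat))) => l + E.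
have lw : l <= size w by rewrite -ltnS.
rewrite inE (tail_fixedE lw) => /eqP hl; rewrite /tl E => il.
have -> : size w - i = (l - i) + (size w - l) by lia.
rewrite -drop_drop hl drop_iota; apply/eqP; congr (iota _ _); lia.
Qed.

Lemma tl_leq w : tl w <= size w.
Proof. by apply/bigmax_leqP => l _; rewrite -ltnS. Qed.

Lemma in_Sn n w : (w \in Sn n) =
  [&& uniq w, size w == n & all (fun x => 0 < x <= n) w].
Proof.
rewrite mem_permutations; apply/idP/and3P => [p|[u /eqP s /allP h]].
  rewrite (perm_uniq p) iota_uniq (perm_size p) size_iota (perm_all _ p); split=> //.
  by apply/allP => x; rewrite mem_iota add1n ltnS.
have sub : {subset w <= iota 1 n} by move=> x /h; rewrite mem_iota add1n ltnS.
apply: uniq_perm => //; first exact: iota_uniq.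
by case: (uniq_min_size u sub) => //; rewrite size_iota s.
Qed.

Lemma SnP n w : w \in Sn n ->
  [/\ uniq w, size w = n & forall x, (x \in w) = (0 < x <= n)].
Proof.
rewrite mem_permutations => p; rewrite (perm_uniq p) iota_uniq (perm_size p) size_iota.
by split=> // x; rewrite (perm_mem p) mem_iota add1n ltnS.
Qed.

Lemma W2P n w : reflect (w \in Sn n /\ avoids231 (ssort w)) (w \in W2 n).
Proof.
rewrite mem_filter andbC; apply: (iffP andP) => -[wS h]; split=> //.
  by apply/sorted_ssortP => //; apply: ssort_uniq; case: (SnP wS).
by apply/sorted_ssortP => //; apply: ssort_uniq; case: (SnP wS).
Qed.

(** * The gluing construction *)

Lemma subseq_ssort_max w x m : uniq w -> m \in w -> {in w, forall y, y <= m} ->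
  x \in w -> x != m -> subseq [:: x; m] (ssort w).
Proof.
move=> uw /splitPr sp; case: sp uw => A B; rewrite cat_uniq /= => /and3P[uA].
rewrite negb_or => /andP[mA _] /andP[mB uB] h xw xm.
rewrite ssort_mid; first last.
- move=> y yB; rewrite ltn_neqAle h ?mem_cat ?inE ?yB ?orbT// andbT.
  by apply: contraNneq mB => <-.
- move=> y yA; rewrite ltn_neqAle h ?mem_cat ?inE ?yA// andbT.
  by apply: contraNneq mA => <-.
rewrite catA subseq2_cat mem_cat !mem_ssort// mem_head andbT.
by move: xw; rewrite mem_cat inE (negPf xm) /= => ->; rewrite orbT.
Qed.

Lemma avoids231_cat_iota W M k : {in W, forall x, x < M} ->
  avoids231 (W ++ iota M k) <-> avoids231 W.
Proof.
move=> WM; split=> h x z y yx xz; apply/negP.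
  move=> s; move/negP: (h x z y yx xz); apply.
  by apply: subseq_trans s _; apply: prefix_subseq.
rewrite subseq3_cat => /or4P[|/andP[/mem_subseq2[/WM xM _]]|/andP[/WM xM /mem_subseq2[_]]|].
- exact/negP/h.
- by rewrite mem_iota; lia.
- by rewrite mem_iota; lia.
- move/(subseq_sorted ltn_trans)/(_ (iota_ltn_sorted _ _)) => /= /and3P[_ zy _].
  by move: (ltn_trans yx xz); rewrite ltnNge ltnW.
Qed.

Lemma legal_space0 w : {in w, forall x, 0 < x} -> legal_space w 0.
Proof.
move=> h; apply/legal_spaceP => x z y y0 _ _; apply/negP => /mem_subseq3[_ _ /h].
by rewrite ltnNge y0.
Qed.

(** On a left block of size [p] only the maximum moves, from [p] to [p + c]; [relabelR] fills the
    values from [p] on, leaving out [p + c] when [p > 0]. *)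
Definition relabelL (p c x : nat) := if x < p then x else x + c.
Definition relabelR (p c x : nat) := if x <= c then x + p - 1 else x + p.

(* The largest entry of [al] is raised over exactly [c] entries of [be]; all
   other entries of [al] stay below all those of [be]. *)
Definition glue (al be : seq nat) (c : nat) : seq nat :=
  map (relabelL (size al) c) al ++ (size al + size be).+1 :: map (relabelR (size al) c) be.

Definition glue_tail al be c l := glue al be c ++ iota (size al + size be).+2 l.

Lemma mono_lt_inj (g : nat -> nat) : {mono g : x y / x < y} -> injective g.
Proof. by move=> h x y E; have := h x y; have := h y x; rewrite E ltnn; lia. Qed.

Lemma relabelL_mono p c : {mono relabelL p c : x y / x < y}.
Proof. by move=> x y; rewrite /relabelL; case: ifP; case: ifP; lia. Qed.

(** For [p = 0 < c] the truncated [x + p - 1] would send both 0 and 1 to 0. An empty left block has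
    nothing to raise and is glued at height 0. *)
Lemma relabelR_mono p c : (p = 0 -> c = 0) -> {mono relabelR p c : x y / x < y}.
Proof. by move=> pc x y; rewrite /relabelR; case: ifP; case: ifP; lia. Qed.

Lemma relabelL_lt p c b x : c <= b -> 0 < x <= p -> 0 < relabelL p c x < (p + b).+1.
Proof. by rewrite /relabelL; case: ifP; lia. Qed.

Lemma relabelR_lt p c b x : (p = 0 -> c = 0) -> 0 < x <= b ->
  0 < relabelR p c x < (p + b).+1.
Proof. by rewrite /relabelR; case: ifP; lia. Qed.

Section Glue.
Variables (al be : seq nat) (p b c l : nat).
Hypotheses (alS : al \in Sn p) (beS : be \in Sn b) (cb : c <= b) (pc : p = 0 -> c = 0).

Let L := relabelL p c.
Let R := relabelR p c.
Let M := (p + b).+1.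

Lemma size_al : size al = p. Proof. by case: (SnP alS). Qed.
Lemma size_be : size be = b. Proof. by case: (SnP beS). Qed.
Lemma uniq_al : uniq al. Proof. by case: (SnP alS). Qed.
Lemma uniq_be : uniq be. Proof. by case: (SnP beS). Qed.
Lemma mem_al x : (x \in al) = (0 < x <= p). Proof. by case: (SnP alS). Qed.
Lemma mem_be x : (x \in be) = (0 < x <= b). Proof. by case: (SnP beS). Qed.

Lemma glueE : glue al be c = map L al ++ M :: map R be.
Proof. by rewrite /glue size_al size_be. Qed.

Lemma glue_tailE : glue_tail al be c l = map L al ++ M :: map R be ++ iota M.+1 l.
Proof. by rewrite /glue_tail glueE size_al size_be -catA. Qed.

Lemma L_mono : {mono L : x y / x < y}.
Proof. exact: relabelL_mono. Qed.

Lemma R_mono : {mono R : x y / x < y}.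
Proof. exact: relabelR_mono pc. Qed.

Lemma L_inj : injective L. Proof. exact: mono_lt_inj L_mono. Qed.

Lemma R_inj : injective R. Proof. exact: mono_lt_inj R_mono. Qed.

Lemma L_lt x : x \in al -> 0 < L x < M.
Proof. by rewrite mem_al; apply: relabelL_lt cb. Qed.

Lemma R_lt x : x \in be -> 0 < R x < M.
Proof. by rewrite mem_be; apply: relabelR_lt pc. Qed.

Lemma uniq_glue : uniq (map L al ++ map R be).
Proof.
rewrite cat_uniq !map_inj_uniq; [|exact: R_inj|exact: L_inj].
rewrite uniq_al uniq_be andbT; apply/hasPn => _ /mapP[y yb ->].
apply/negP => /mapP[x]; move: yb; rewrite mem_al mem_be /L /R /relabelL /relabelR.
by have := pc; case: ifP; case: ifP; lia.
Qed.

Lemma uniq_glue_tail : uniq (glue_tail al be c l).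
Proof.
rewrite glue_tailE -cat1s uniq_catCA cat1s cons_uniq catA cat_uniq uniq_glue iota_uniq andbT.
rewrite mem_cat mem_iota ltnn orbF; apply/andP; split.
  rewrite mem_cat; apply/norP; split; apply/mapP => -[x].
    by move/L_lt => + E; rewrite -E ltnn andbF.
  by move/R_lt => + E; rewrite -E ltnn andbF.
apply/hasPn => x; rewrite mem_iota => /andP[Mx _]; rewrite mem_cat.
apply/norP; split; apply/mapP => -[y].
  by move/L_lt/andP => [_ h] E; move: Mx; rewrite E ltnNge ltnW.
by move/R_lt/andP => [_ h] E; move: Mx; rewrite E ltnNge ltnW.
Qed.

Lemma glue_tail_Sn : glue_tail al be c l \in Sn (p + b + 1 + l).
Proof.
rewrite in_Sn uniq_glue_tail /= glue_tailE size_cat /= size_cat !size_map size_iota.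
rewrite size_al size_be; apply/andP; split; first by apply/eqP; lia.
rewrite all_cat /= all_cat; rewrite !all_map; apply/and4P; split.
- by apply/allP => x /L_lt /=; rewrite /M; lia.
- by rewrite /M; lia.
- by apply/allP => x /R_lt /=; rewrite /M; lia.
- by apply/allP => x; rewrite mem_iota /M; lia.
Qed.

Lemma ssort_glue_tail : ssort (glue_tail al be c l) =
  (map L (ssort al) ++ map R (ssort be)) ++ iota M l.+1.
Proof.
rewrite glue_tailE -cat_cons catA ssort_cat_incr ?iota_ltn_sorted//; last first.
  move=> x y; rewrite mem_iota mem_cat inE => /or3P[/mapP[z /L_lt + ->]|/eqP->|/mapP[z /R_lt + ->]]; lia.
rewrite ssort_mid; first last.
- by move=> _ /mapP[x /R_lt/andP[_ ?] ->].
- by move=> _ /mapP[x /L_lt/andP[_ ?] ->].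
rewrite !ssort_map ?uniq_al ?uniq_be -?catA//; first by move=> x y _ _; apply: R_mono.
by move=> x y _ _; apply: L_mono.
Qed.

(** A 231 pattern meeting both blocks starts with the raised maximum and goes on with an inversion
    of [ssort be] whose values lie on either side of [c]. By [subseq2_ssort] such an inversion is a
    pattern of [be] that makes [c] illegal. *)
Lemma avoids231_glue_tail :
  avoids231 (ssort (glue_tail al be c l)) <->
  [/\ avoids231 (ssort al), avoids231 (ssort be) & legal_space be c].
Proof.
have ml x : x \in map L (ssort al) -> exists2 x', x' \in al & x = L x'.
  by case/mapP => x' + ->; rewrite mem_ssort ?uniq_al//; exists x'.
have mr x : x \in map R (ssort be) -> exists2 x', x' \in be & x = R x'.
  by case/mapP => x' + ->; rewrite mem_ssort ?uniq_be//; exists x'.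
rewrite ssort_glue_tail avoids231_cat_iota; last first.
  move=> x; rewrite mem_cat => /orP[/ml[x' /L_lt/andP[_ +] ->]//|/mr[x' /R_lt/andP[_ +] ->]//].
split=> [h|[hA hB /legal_spaceP hc] x z y yx xz].
  split.
  - move=> x z y yx xz; apply/negP => s.
    have := h (L x) (L z) (L y); rewrite !L_mono => /(_ yx xz)/negP; apply.
    by rewrite subseq3_cat (map_subseq L s).
  - move=> x z y yx xz; apply/negP => s.
    have := h (R x) (R z) (R y); rewrite !R_mono => /(_ yx xz)/negP; apply.
    by rewrite subseq3_cat (map_subseq R s) !orbT.
  - apply/legal_spaceP => x z y yc cx xz; apply/negP => s.
    have yx := leq_ltn_trans yc cx.
    have s2 : subseq [:: x; y] (ssort be).
      by apply/(subseq2_ssort uniq_be yx); exists z.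
    have [_ _] := mem_subseq3 s; rewrite mem_be => /andP[y0 _].
    have p0 : 0 < p by have := pc; lia.
    have pal : p \in al by rewrite mem_al p0 /=.
    have h1 : R y < L p by rewrite /L /R /relabelL /relabelR ltnn yc; lia.
    have h2 : L p < R x by rewrite /L /R /relabelL /relabelR ltnn; case: ifP; lia.
    move/negP: (h _ _ _ h1 h2); apply.
    rewrite subseq3_cat; apply/or4P; apply: Or43.
    by rewrite map_f ?mem_ssort ?uniq_al//; exact: (map_subseq R s2).
apply/negP; rewrite subseq3_cat => /or4P[|/andP[/mem_subseq2[]]|/andP[]|].
- case/subseq_mapl => -[|x' [|z' [|y' []]]] // s [ex ez ey]; subst.
  by move: s; apply/negP/hA; rewrite -L_mono.
(* Only the maximum of the left block can exceed an entry of the right one, so it would have to be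
   [x], leaving no larger [z] in that block. *)
- move=> /ml[x' x'a ex] /ml[z' z'a ez] /mr[y' y'b ey]; subst.
  move: yx xz x'a z'a y'b; rewrite L_mono mem_al mem_al mem_be /L /R /relabelL /relabelR.
  by case: ifP; case: ifP; lia.
- move=> /ml[x' x'a ex] /subseq_mapl[[|z' [|y' []]] //] s [ez ey]; subst.
  have [z'b y'b] := mem_subseq2 s.
  move: z'b y'b x'a; rewrite !mem_ssort ?uniq_be// !mem_be mem_al => z'b y'b x'a.
  have y'z' : y' < z' by rewrite -R_mono (ltn_trans yx).
  have /(subseq2_ssort uniq_be y'z')[w zw] := s; apply/negP; apply: hc => //.
    by move: yx; rewrite /L /R /relabelL /relabelR; case: ifP; case: ifP; lia.
  by move: yx xz; rewrite /L /R /relabelL /relabelR; do 3!case: ifP; lia.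
- case/subseq_mapl => -[|x' [|z' [|y' []]]] // s [ex ez ey]; subst.
  by move: s; apply/negP/hB; rewrite -R_mono.
Qed.

Let V := M :: map R be ++ iota M.+1 l.

Lemma L_ge x : x <= L x. Proof. by rewrite /L /relabelL; case: ifP; lia. Qed.

Lemma V_ge y : y \in V -> p <= y.
Proof.
rewrite inE mem_cat mem_iota => /or3P[/eqP->|/mapP[x xb ->]|]; rewrite /M; try lia.
by move: xb; rewrite mem_be /R /relabelR; have := pc; case: ifP; lia.
Qed.

(** Values below [p] occur only in the left block; the last entry of a violating pattern is among
    them, so the whole pattern lies there. *)
Lemma legal_glue_low a : a < p ->
  legal_space (glue_tail al be c l) a = legal_space al a.
Proof.
move=> ap; rewrite glue_tailE -/V; apply/legal_spaceP/legal_spaceP => h x z y ya ax xz.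
  apply/negP => s.
  have h1 : L y <= a by rewrite /L /relabelL; case: ifP; lia.
  have h2 : a < L x by apply: leq_trans (L_ge x).
  have h3 : L x < L z by rewrite L_mono.
  move/negP: (h _ _ _ h1 h2 h3); apply.
  by rewrite subseq3_cat (map_subseq L s).
have yV : y \notin V by apply/negP => /V_ge; lia.
rewrite subseq3_cat (negPf yV) andbF orFb; apply/negP.
case/or3P => [|/andP[_ /mem_subseq2[]]|/mem_subseq3[]]; rewrite ?(negPf yV)//.
case/subseq_mapl => -[|x' [|z' [|y' []]]] // s [ex ez ey]; subst.
apply: (negP (h x' z' y' _ _ _) s).
- exact: leq_trans (L_ge y') ya.
- by move: ax; rewrite /L /relabelL; case: ifP; lia.
- by rewrite -L_mono.
Qed.

(** The violation is the raised maximum, then [M], then the smallest entry [R 1 = p] of the right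
    block. *)
Lemma legal_glue_mid a : p <= a < p + c ->
  legal_space (glue_tail al be c l) a = false.
Proof.
move=> ha; have p0 : 0 < p by have := pc; lia.
apply/negbTE/legal_spaceP => /(_ (L p) M (R 1)).
have pal : p \in al by rewrite mem_al p0 /=.
have h1 : R 1 <= a by rewrite /R /relabelR; case: ifP; lia.
have h2 : a < L p by rewrite /L /relabelL ltnn; lia.
have /andP[_ h3] := L_lt pal.
move=> /(_ h1 h2 h3)/negP; apply; rewrite glue_tailE subseq3_cat; apply/or4P; apply: Or43.
rewrite map_f//= eqxx sub1seq mem_cat map_f// mem_be; lia.
Qed.

(** The left block has no entry above [p + c], and [M] cannot start a violation since everything
    larger lies in the final increasing tail. *)
Lemma legal_glue_high a : c <= a <= b ->
  legal_space (glue_tail al be c l) (p + a) = legal_space be a.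
Proof.
move=> ha; rewrite glue_tailE -/V; apply/legal_spaceP/legal_spaceP => h x z y ya ax xz.
  apply/negP => s.
  have h1 : R y <= p + a by rewrite /R /relabelR; case: ifP; lia.
  have h2 : p + a < R x by rewrite /R /relabelR; case: ifP; lia.
  have h3 : R x < R z by rewrite R_mono.
  move/negP: (h _ _ _ h1 h2 h3); apply.
  apply: subseq_trans (map_subseq R s) _; apply: subseq_trans (suffix_subseq _ V).
  by apply: subseq_trans (subseq_cons _ _); apply: prefix_subseq.
have xA : x \notin map L al.
  apply/negP => /mapP[x']; rewrite mem_al /L /relabelL => + E; rewrite E in ax.
  by move: ax; case: ifP; lia.
have yI : y \notin iota M.+1 l by rewrite mem_iota /M; lia.
have sI s : subseq s (iota M.+1 l) -> sorted ltn s.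
  by move/(subseq_sorted ltn_trans); apply; apply: iota_ltn_sorted.
have yz := leq_ltn_trans ya (ltn_trans ax xz).
rewrite subseq3_cat (negPf xA) andFb orFb; apply/negP => /or3P[/mem_subseq3[]|/andP[/mem_subseq2[]]|];
  rewrite ?(negPf xA)//.
have xz' : x != M -> subseq [:: x; z; y] V -> False.
  move=> xM; rewrite subseq_cons_neq// subseq3_cat (negPf yI) andbF orFb.
  case/or3P => [/subseq_mapl[[|x' [|z' [|y' []]]]] // s [ex ez ey]|/andP[_ /mem_subseq2[]]|/mem_subseq3[]];
    rewrite ?(negPf yI)//.
  subst; apply: (negP (h x' z' y' _ _ _) s).
  - by move: ya; rewrite /R /relabelR; case: ifP; lia.
  - by move: ax; rewrite /R /relabelR; case: ifP; lia.
  - by rewrite -R_mono.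
case: (eqVneq x M) => [xM|/xz'//];  move=> s.
have : subseq [:: z; y] (map R be ++ iota M.+1 l) by move: s; rewrite /V xM /= eqxx.
rewrite subseq2_cat (negPf yI) andbF orFb.
case/orP => [/mem_subseq2[/mapP[z' /R_lt/andP[_ +] E]]|/mem_subseq2[]]; rewrite ?(negPf yI)//.
by rewrite -E -xM ltnNge ltnW.
Qed.

Lemma legal_glue_top a : M <= a -> legal_space (glue_tail al be c l) a.
Proof.
move=> Ma; apply/legal_spaceP => x z y ya ax xz.
have xW : x \notin glue al be c.
  rewrite glueE mem_cat inE negb_or; apply/andP; split; first by apply/mapP => -[x' /L_lt]; lia.
  by rewrite negb_or; apply/andP; split; [lia | apply/mapP => -[x' /R_lt]; lia].
rewrite /glue_tail subseq3_cat (negPf xW) andFb orFb.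
apply/negP => /or3P[/mem_subseq3[]|/andP[/mem_subseq2[]]|]; rewrite ?(negPf xW)//.
move/(subseq_sorted ltn_trans)/(_ (iota_ltn_sorted _ _)) => /= /and3P[_ zy _].
by have := ltn_trans (leq_ltn_trans ya ax) xz; rewrite ltnNge ltnW.
Qed.

Lemma size_glue_tail : size (glue_tail al be c l) = p + b + 1 + l.
Proof. by case: (SnP glue_tail_Sn). Qed.

(** The spaces are cut at [p], [p + c] and [M]. The first count omits the always legal top space of
    [al], so it is [leg al - 1]; the [l.+1] spaces from [M] on are all legal. *)
Lemma leg_glue_tail : leg (glue_tail al be c l) =
  count (legal_space al) (iota 0 p) +
  count (fun a => (c <= a) && legal_space be a) (iota 0 b.+1) + l.+1.
Proof.
have -> : count (fun a => (c <= a) && legal_space be a) (iota 0 b.+1) =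
    count (legal_space be) (iota c (b.+1 - c)).
  rewrite -[iota 0 b.+1](cat_take_drop c) take_iota drop_iota count_cat.
  rewrite (minn_idPl _); last by lia.
  rewrite (@eq_in_count _ _ pred0) ?count_pred0 ?add0n; last first.
    by move=> a; rewrite mem_iota add0n => /andP[_ ac]; rewrite leqNgt ac.
  by apply: eq_in_count => a; rewrite mem_iota => /andP[->].
rewrite /leg size_glue_tail.
have -> : (p + b + 1 + l).+1 = p + (c + ((b.+1 - c) + l.+1)) by lia.
rewrite !iotaD !count_cat !add0n -!addnA; congr (_ + _).
  by apply: eq_in_count => a; rewrite mem_iota /= => /legal_glue_low.
rewrite (@eq_in_count _ _ pred0) ?count_pred0 ?add0n; last first.
  by move=> a; rewrite mem_iota => /legal_glue_mid.
congr (_ + _).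
  rewrite iotaDl count_map; apply: eq_in_count => a; rewrite mem_iota => ha /=.
  by rewrite legal_glue_high//; lia.
rewrite (@eq_in_count _ _ predT) ?count_predT ?size_iota// => a; rewrite mem_iota => ha.
by apply: legal_glue_top; rewrite /M; lia.
Qed.

(** A nonempty right block pushes [M] ahead of its own position, which stops the tail. *)
Lemma tl_glue_tail : 0 < b -> tl (glue_tail al be c l) = l.
Proof.
move=> b0; have sz := size_glue_tail; apply/eqP; rewrite eqn_leq; apply/andP; split.
  rewrite leqNgt leq_tl ?sz; last by lia.
  have -> : p + b + 1 + l - l.+1 = p + b by lia.
  apply/negP => /eqP E.
  have : M \in drop (p + b) (glue_tail al be c l) by rewrite E mem_head.
  have -> : p + b = b.-1 + (size (map L al)).+1 by rewrite size_map size_al; lia.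
  rewrite glue_tailE drop_cat.
  have -> : b.-1 + (size (map L al)).+1 < size (map L al) = false by lia.
  have -> : b.-1 + (size (map L al)).+1 - size (map L al) = b.-1.+1 by lia.
  rewrite [drop _ _]/= => /mem_drop; rewrite mem_cat mem_iota ltnn orbF => /mapP[x /R_lt].
  by move=> /andP[_ +] E2; rewrite -E2 ltnn.
rewrite leq_tl ?sz ?leq_addl//; have -> : p + b + 1 + l - l = p + b + 1 by lia.
by rewrite /glue_tail drop_size_cat ?glueE ?size_cat /= ?size_map size_al size_be ?addn1// addnS.
Qed.

(** The [l - j] entries put after [al] stand for [M] and the [l - j - 1] tail entries behind the
    skipped one. *)
Lemma fertility_glue_tail : 0 < b -> fertility (glue_tail al be c l) =
  \sum_(0 <= j < l) fertility (al ++ iota p.+1 (l - j)) * fertility (be ++ iota b.+1 j).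
Proof.
move=> b0; rewrite glue_tailE fertility_decomp.
- rewrite size_iota; apply: eq_big_nat => j /andP[_ jl]; congr (_ * _).
    have E : size (M :: drop j.+1 (iota M.+1 l)) = l - j.
      by rewrite /= drop_iota size_iota subnSK.
    rewrite (@fertility_ext L _ p.+1) ?uniq_al// ?E//.
    + by move=> x; rewrite mem_al => /andP[_ ?]; rewrite ltnS.
    + by move=> x y _ _; apply: L_mono.
    + rewrite drop_iota /= (path_sortedE ltn_trans) iota_ltn_sorted andbT.
      by apply/allP => x; rewrite mem_iota /=; lia.
    + move=> x y /L_lt/andP[_ xM]; rewrite inE drop_iota mem_iota => /orP[/eqP->//|]; lia.
  rewrite (@fertility_ext R _ b.+1) ?uniq_be//=.
  + by rewrite take_iota size_iota (minn_idPl _)// ltnW.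
  + by move=> x; rewrite mem_be => /andP[_ ?]; rewrite ltnS.
  + by move=> x y _ _; apply: R_mono.
  + by rewrite take_iota iota_ltn_sorted.
  + by move=> x y /R_lt/andP[_ xM]; rewrite take_iota mem_iota; lia.
- by rewrite -size_eq0 size_map size_be -lt0n.
- by rewrite -glue_tailE uniq_glue_tail.
- by move=> _ /mapP[x /L_lt/andP[_ ?] ->].
- by move=> _ /mapP[x /R_lt/andP[_ ?] ->].
- exact: (iota_ltn_sorted M l.+1).
Qed.

End Glue.

(** * Every 2-stack-sortable permutation is glued *)

(** The word reveals its data: [l] is the tail length, [p] the position of [M], and [c] shows in the
    maximum of the left block. *)
Lemma glue_tail_inj al be c l al' be' c' l' p b p' b' :
  al \in Sn p -> be \in Sn b -> c <= b -> (p = 0 -> c = 0) -> 0 < b ->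
  al' \in Sn p' -> be' \in Sn b' -> c' <= b' -> (p' = 0 -> c' = 0) -> 0 < b' ->
  glue_tail al be c l = glue_tail al' be' c' l' ->
  [/\ al = al', be = be', c = c' & l = l'].
Proof.
move=> alS beS cb pc b0 alS' beS' cb' pc' b0' E.
have El : l = l'.
  by rewrite -(tl_glue_tail l alS beS cb pc b0) E (tl_glue_tail l' alS' beS' cb' pc' b0').
have Es : p + b + 1 + l = p' + b' + 1 + l'.
  by rewrite -(size_glue_tail l alS beS cb pc) E (size_glue_tail l' alS' beS' cb' pc').
have Epb : p + b = p' + b' by lia.
move: E; rewrite !(glue_tailE _ _ alS beS) !(glue_tailE _ _ alS' beS') -Epb => E.
have nM q q' d (w : seq nat) : w \in Sn q -> d <= q' -> (p + b).+1 = (q + q').+1 ->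
    (p + b).+1 \notin map (relabelL q d) w.
  move=> wS dq ->; apply/negP => /mapP[x xw]; have := L_lt wS dq xw.
  by move=> /andP[_ +] E2; rewrite -E2 ltnn.
have E1 : p = p'.
  have := index_mid (map (relabelR p c) be ++ iota (p + b).+2 l) (nM _ _ _ _ alS cb erefl).
  rewrite E index_mid; last by apply: nM alS' cb' _; rewrite Epb.
  by rewrite !size_map (size_al alS) (size_al alS').
subst p' l'; have {Epb} Eb : b = b' by lia.
subst b'.
have Esz : size (map (relabelL p c) al) = size (map (relabelL p c') al').
  by rewrite !size_map (size_al alS) (size_al alS').
move/eqP: E; rewrite eqseq_cat// eqseq_cons eqxx /= eqseq_cat; last first.
  by rewrite !size_map (size_be beS) (size_be beS').
move=> /and3P[/eqP EL /eqP ER _].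
have Ec : c = c'.
  have [p0|p0] := posnP p; first by rewrite pc// pc'.
  have h d d' (w w' : seq nat) : w \in Sn p -> w' \in Sn p ->
      map (relabelL p d) w = map (relabelL p d') w' -> d <= d'.
    move=> wS wS' EE; have : relabelL p d p \in map (relabelL p d) w.
      by apply: map_f; rewrite (mem_al wS) p0 /=.
    rewrite EE => /mapP[x]; rewrite (mem_al wS') /relabelL ltnn.
    by case: ifP; lia.
  by apply/eqP; rewrite eqn_leq (h _ _ _ _ alS alS' EL) (h _ _ _ _ alS' alS (esym EL)).
subst c'; split=> //; first by apply: inj_map EL; apply: L_inj.
by apply: inj_map ER; apply: R_inj.
Qed.

Lemma glue_tail_surj n w : w \in W2 n -> w != iota 1 n ->
  exists al be c l p b, [/\ w = glue_tail al be c l, al \in W2 p, be \in W2 b &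
    [/\ legal_space be c, c <= b, p = 0 -> c = 0, 0 < b & p + b + 1 + l = n]].
Proof.
case/W2P => wS wav wid; have [uw sw mw] := SnP wS.
set l := tl w; have ln : l <= n by rewrite -sw; apply: tl_leq.
have lltn : l < n.
  rewrite ltn_neqAle ln andbT; apply: contra wid => /eqP lEn.
  have := leqnn l; rewrite -{2}/l leq_tl ?sw// lEn subnn drop0 => /eqP->.
  by [].
have [m En] : exists m, n = m + 1 + l by exists (n - l - 1); lia.
have Dl : drop m.+1 w = iota m.+2 l.
  have := leqnn l; rewrite -{2}/l leq_tl ?sw// => /eqP.
  by have -> : n - l = m.+1 by lia.
have Ew : w = take m.+1 w ++ iota m.+2 l by rewrite -Dl cat_take_drop.
move: (take _ _) Ew => W Ew.
have sW : size W = m.+1.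
  by move: sw; rewrite Ew size_cat size_iota; lia.
have memW x : (x \in W) = (0 < x <= m.+1).
  have := mw x; have := uw; rewrite Ew cat_uniq mem_cat mem_iota => /and3P[_ /hasPn h _].
  have := h x; rewrite mem_iota /=.
  by case: (x \in W) => /=; lia.
have : m.+1 \in W by rewrite memW /=.
move=> /splitPr sp; case: sp sW memW Ew => A B sW memW Ew.
have uW : uniq (A ++ m.+1 :: B) by move: uw; rewrite Ew cat_uniq => /and3P[].
have := uW; rewrite cat_uniq /= => /and3P[uA].
rewrite negb_or => /andP[MA /hasPn dAB] /andP[MB uB].
have memAB x : (x \in A) || (x \in B) = (0 < x <= m).
  have := memW x; rewrite mem_cat inE; case: (eqVneq x m.+1) => [->|xM].
    by rewrite (negPf MA) (negPf MB) ltnn andbF.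
  by move=> ->; move: xM; lia.
have hA x : x \in A -> 0 < x <= m by move=> xA; rewrite -memAB xA.
have hB x : x \in B -> 0 < x <= m by move=> xB; rewrite -memAB xB orbT.
(* Otherwise [m.+1] would sit at its own position and prolong the tail. *)
have B0 : B != [::].
  apply/negP => /eqP B0; have : l.+1 <= l; last by rewrite ltnn.
  rewrite {2}/l leq_tl sw//; apply/eqP.
  have -> : n - l.+1 = m by lia.
  rewrite Ew B0 cats1 cat_rcons drop_size_cat//.
  by move: sW; rewrite B0 size_cat /=; lia.
have [p Ep] : exists p, p = size A by exists (size A).
have [b Eb] : exists b, b = size B by exists (size B).
have Em : m = p + b by move: sW; rewrite size_cat /= -Ep -Eb; lia.
have b0 : 0 < b by rewrite Eb lt0n size_eq0.
pose mA := maxentry A.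
have mAle x : x \in A -> x <= mA by apply: maxentry_ge.
have mAin : 0 < p -> mA \in A.
  by move=> p0; apply: maxentry_in; rewrite -size_eq0 -Ep -lt0n.
(* If [y < x], then [x], [mA], [y] is a 231 pattern of [ssort w], because [s] moves [mA] to the end
   of its block. *)
have AB x y : x \in A -> y \in B -> x != mA -> x < y.
  move=> xA yB xmA; rewrite ltnNge; apply/negP => yx.
  have yltx : y < x.
    by rewrite ltn_neqAle yx andbT; apply: contraTneq yB => ->; apply: contraL xA; apply: dAB.
  have p0 : 0 < p by rewrite Ep; case: (A) xA.
  have xmA' : x < mA by rewrite ltn_neqAle xmA mAle.
  have /negP := wav x mA y yltx xmA'; apply.
  rewrite Ew ssort_cat_incr ?iota_ltn_sorted//; last first.
    move=> u v; rewrite mem_iota memW.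
    by move=> /andP[_ um] /andP[mv _]; apply: leq_ltn_trans um mv.
  rewrite ssort_mid; first last.
  - by move=> u /hB/andP[].
  - by move=> u /hA/andP[].
  apply: subseq_trans (prefix_subseq _ _); rewrite catA.
  apply: subseq_trans (prefix_subseq _ _); rewrite subseq3_cat; apply/or4P; apply: Or42.
  by rewrite subseq_ssort_max ?mAin// mem_ssort.
(* All values up to [x] lie in [A] without [mA], which has [p - 1] entries. *)
have small x : x \in A -> x != mA -> x < p.
  move=> xA xmA; have p0 : 0 < p by rewrite Ep; case: (A) xA.
  have xmA' : x < mA by rewrite ltn_neqAle xmA mAle.
  suff : size (iota 1 x) <= size (rem mA A).
    by rewrite size_iota size_rem ?mAin// -Ep; move: p0; clear; lia.
  apply: uniq_leq_size; first exact: iota_uniq.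
  move=> y; rewrite mem_iota mem_rem_uniq// inE => yx.
  have /andP[x0 xm] := hA _ xA.
  have /orP[yA|yB] : (y \in A) || (y \in B).
    by rewrite memAB; move: yx xm; clear; lia.
    by rewrite yA andbT; move: yx xmA'; clear; lia.
  by have := AB _ _ xA yB xmA; move: yx; clear; lia.
(* Conversely, the [p - 1] entries of [A] other than [mA] are all below [y]. *)
have large y : y \in B -> p <= y.
  move=> yB; have [->//|p0] := posnP p.
  have /andP[y0 ym] := hB _ yB.
  suff : size (rem mA A) <= size (iota 1 y.-1).
    by rewrite size_iota size_rem ?mAin// -Ep; move: p0 y0; clear; lia.
  apply: uniq_leq_size; first exact: rem_uniq.
  move=> x; rewrite mem_rem_uniq// inE => /andP[xmA xA]; rewrite mem_iota.
  by have := AB _ _ xA yB xmA; have := hA _ xA; clear; lia.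
have pmA : p <= mA.
  have [->//|p0] := posnP p.
  rewrite Ep -[mA](size_iota 1); apply: uniq_leq_size => // x xA.
  by have := hA _ xA; have := mAle _ xA; rewrite mem_iota; clear; lia.
have mAm : mA <= m.
  by have [p0|/mAin/hA/andP[]//] := posnP p; rewrite /mA; case: (A) Ep p0 => [|? ?] /= -> //.
have mAB y : y \in B -> y != mA.
  move=> yB; apply/eqP => E; have [p0|/mAin] := posnP p.
    by have := hB _ yB; rewrite E /mA; case: (A) Ep p0 => [|? ?] /= ->.
  by rewrite -E; apply/negP/dAB.
(* Only [mA] can exceed [p], so capping at [p] standardises [A], and [c] is the amount by which its
   maximum was raised. *)
pose al := map (minn p) A; pose c := mA - p.
pose be := map (fun y => if y < mA then y.+1 - p else y - p) B.
have alS : al \in Sn p.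
  rewrite in_Sn size_map -Ep eqxx map_inj_in_uniq ?uA//=; last first.
    move=> x y xA yA; have := small x xA; have := small y yA.
    by case: (eqVneq x mA) => [->|_]; case: (eqVneq y mA) => [->|_] //;
      move: pmA; clear; lia.
  apply/allP => _ /mapP[x xA ->]; have := hA _ xA.
  have : 0 < p by rewrite Ep; case: (A) xA.
  by clear; lia.
have beS : be \in Sn b.
  rewrite in_Sn size_map -Eb eqxx map_inj_in_uniq ?uB//=; last first.
    move=> x y xB yB; have := large x xB; have := large y yB.
    have := mAB x xB; have := mAB y yB; clear; case: ifP; case: ifP; lia.
  apply/allP => _ /mapP[x xB ->]; have := hB _ xB; have := large _ xB; have := mAB x xB.
  by move: Em mAm pmA; clear; case: ifP; lia.
have pc : p = 0 -> c = 0.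
  by move=> p0; rewrite /c /mA; case: (A) Ep p0 => [|? ?] /= ->.
have cb : c <= b by rewrite /c; move: mAm Em; clear; lia.
have E : w = glue_tail al be c l.
  rewrite (glue_tailE _ _ alS beS) Ew -catA cat_cons Em /al /be -!map_comp.
  congr (_ ++ _ :: (_ ++ _)); apply/esym/map_id_in => x xM /=.
    rewrite /relabelL /c; have := small x xM; have := mAle x xM.
    by case: (eqVneq x mA) => [->|_]; move: pmA; clear; case: ifP; lia.
  rewrite /relabelR /c; have := large x xM; have := hB x xM; have := mAB x xM.
  by move: pmA; clear; case: ifP; case: ifP; lia.
move: wav; rewrite E; case/(avoids231_glue_tail l alS beS cb pc) => avA avB leg.
exists al, be, c, l, p, b; split => //; first by apply/W2P.
  by apply/W2P.
by split=> //; rewrite En Em.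
Qed.

Lemma W2_uniq n : uniq (W2 n).
Proof. by rewrite filter_uniq// permutations_uniq. Qed.

Lemma avoids231_sorted w : sorted ltn w -> avoids231 w.
Proof.
move=> sw x z y yx xz; apply/negP => /(subseq_sorted ltn_trans)/(_ sw) /= /and3P[_ zy _].
by have := ltn_trans yx xz; rewrite ltnNge ltnW.
Qed.

Lemma iota_W2 n : iota 1 n \in W2 n.
Proof.
apply/W2P; split; first by rewrite mem_permutations.
by apply: avoids231_sorted; rewrite -[iota 1 n]cat0s ssort_cat_incr ?iota_ltn_sorted.
Qed.

Lemma legal_space_size p w : w \in Sn p -> legal_space w p.
Proof.
case/SnP => _ _ mw; apply/legal_spaceP => x z y _ px _; apply/negP => /mem_subseq3[+ _ _].
by rewrite mw => /andP[_]; rewrite leqNgt px.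
Qed.

Lemma leg_count p w : w \in Sn p -> leg w = (count (legal_space w) (iota 0 p)).+1.
Proof.
move=> wS; have [_ sw _] := SnP wS; rewrite /leg sw -addn1 iotaD count_cat /= add0n.
by rewrite legal_space_size// addn1.
Qed.

(** * Appending fixed points *)

Section AddTail.
Variables (p i : nat) (al : seq nat).
Hypothesis alS : al \in Sn p.

Lemma add_tail_Sn : al ++ iota p.+1 i \in Sn (p + i).
Proof.
move: alS; rewrite !mem_permutations iotaD add1n => h.
by rewrite perm_cat2r.
Qed.

Lemma add_tail_W2 : (al ++ iota p.+1 i \in W2 (p + i)) = (al \in W2 p).
Proof.
have [ual _ mal] := SnP alS.
have E : ssort (al ++ iota p.+1 i) = ssort al ++ iota p.+1 i.
  rewrite ssort_cat_incr ?iota_ltn_sorted// => x y; rewrite mal mem_iota.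
  by move=> /andP[_ xp] /andP[+ _]; apply: leq_ltn_trans.
have h : avoids231 (ssort al ++ iota p.+1 i) <-> avoids231 (ssort al).
  apply: avoids231_cat_iota => x; rewrite mem_ssort// mal => /andP[_].
  by rewrite ltnS.
apply/W2P/W2P; rewrite E h => -[_ ?]; split=> //; exact: add_tail_Sn.
Qed.

Lemma leg_add_tail : leg (al ++ iota p.+1 i) = leg al + i.
Proof.
have [ual sal mal] := SnP alS.
rewrite /leg size_cat size_iota sal -addSn iotaD count_cat; congr (_ + _).
  apply: eq_in_count => a; rewrite mem_iota add0n ltnS /= => ap.
  apply/legal_spaceP/legal_spaceP => h x z y ya ax xz.
    apply/negP => s; apply: (negP (h _ _ _ ya ax xz)).
    exact: subseq_trans s (prefix_subseq _ _).
  have yI : y \notin iota p.+1 i by rewrite mem_iota; lia.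
  rewrite subseq3_cat (negPf yI) andbF orFb; apply/negP.
  case/or3P => [|/andP[_ /mem_subseq2[]]|/mem_subseq3[]]; rewrite ?(negPf yI)//.
  exact/negP/h.
rewrite (@eq_in_count _ _ predT) ?count_predT ?size_iota// => a.
rewrite mem_iota add0n => /andP[pa _]; apply/legal_spaceP => x z y ya ax xz.
have xA : x \notin al by rewrite mal; lia.
rewrite subseq3_cat (negPf xA) andFb orFb; apply/negP.
case/or3P => [/mem_subseq3[]|/andP[/mem_subseq2[]]|]; rewrite ?(negPf xA)//.
move/(subseq_sorted ltn_trans)/(_ (iota_ltn_sorted _ _)) => /= /and3P[_ zy _].
by have := ltn_trans (leq_ltn_trans ya ax) xz; rewrite ltnNge ltnW.
Qed.

End AddTail.

(** Trades a lower bound on the tail length for appended entries; this is the source of the divided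
    differences in [v]. *)
Lemma W2_tl_geq n i : i <= n ->
  perm_eq [seq w <- W2 n | i <= tl w] [seq al ++ iota (n - i).+1 i | al <- W2 (n - i)].
Proof.
move=> ni; apply: uniq_perm; first by rewrite filter_uniq ?W2_uniq.
  rewrite map_inj_in_uniq ?W2_uniq// => x y /W2P[/SnP[_ sx _] _] /W2P[/SnP[_ sy _] _].
  by move/eqP; rewrite eqseq_cat ?sx// eqxx andbT => /eqP.
move=> w; rewrite mem_filter; apply/andP/mapP => [[]|[al hal ->]]; last first.
  have [alS _] := W2P _ _ hal; have := add_tail_W2 i alS; have := add_tail_Sn i alS.
  rewrite subnK// => wS ->; split=> //; have [_ sw _] := SnP wS.
  by rewrite leq_tl sw// drop_size_cat//; case: (SnP alS).
move=> + wW; have [wS wav] := W2P _ _ wW; have [uw sw mw] := SnP wS.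
rewrite leq_tl sw// => /eqP E; exists (take (n - i) w); last by rewrite -E cat_take_drop.
have Ew : w = take (n - i) w ++ iota (n - i).+1 i by rewrite -E cat_take_drop.
have tS : take (n - i) w \in Sn (n - i).
  move: wS; rewrite !mem_permutations -{1}(subnK ni) iotaD add1n {1}Ew.
  by rewrite perm_cat2r.
by rewrite -(add_tail_W2 i tS) subnK// -Ew.
Qed.

(** * Enumeration by gluing data *)

Lemma uniq_pairs_dep (S T : eqType) (s : seq S) (t : S -> seq T) :
  uniq s -> {in s, forall x, uniq (t x)} -> uniq [seq (x, y) | x <- s, y <- t x].
Proof.
move=> us ut; apply: allpairs_uniq_dep => //.
move=> q r /allpairsPdep[x [y [_ _ {q}->]]] /allpairsPdep[x' [y' [_ _ {r}->]]] /= [-> ->].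
by [].
Qed.

Lemma mem_pairs_dep (S T : eqType) (s : seq S) (t : S -> seq T) x y :
  ((x, y) \in [seq (x, y) | x <- s, y <- t x]) = (x \in s) && (y \in t x).
Proof.
apply/allpairsPdep/andP => [[x' [y' [xs yt [-> ->]]]]//|[xs yt]].
by exists x, y.
Qed.

Definition heights (al be : seq nat) : seq nat :=
  if al is [::] then [:: 0] else [seq c <- iota 0 (size be).+1 | legal_space be c].

(** The bound on [p] keeps the right block, of size [n - l - 1 - p], nonempty, which excludes the
    identity. *)
Definition glue_index (n : nat) : seq ((nat * nat) * ((seq nat * seq nat) * nat)) :=
  [seq (lp, x) | lp <- [seq (l, p) | l <- iota 0 n, p <- iota 0 (n - l - 1)],
     x <- [seq (ab, c) |
            ab <- [seq (al, be) | al <- W2 lp.2, be <- W2 (n - lp.1 - 1 - lp.2)],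
            c <- heights ab.1 ab.2]].

Lemma heightsP p b al be c : al \in Sn p -> be \in Sn b ->
  c \in heights al be <-> [/\ c <= b, p = 0 -> c = 0 & legal_space be c].
Proof.
move=> alS beS; have [_ sal _] := SnP alS; have [_ sbe mbe] := SnP beS.
rewrite /heights; case: al sal {alS} => [<-|x al <-].
  rewrite inE; split=> [/eqP->|[_ h _]]; last by rewrite h.
  by split=> //; apply: legal_space0 => x; rewrite mbe => /andP[].
rewrite mem_filter mem_iota add0n sbe ltnS.
by split=> [/and3P[lc _ cb]|[cb _ lc]]; [split | apply/and3P; split].
Qed.

Lemma glue_indexP n l p al be c :
  reflect [/\ al \in W2 p, be \in W2 (n - l - 1 - p), c \in heights al be & l + p + 1 < n]
    (((l, p), ((al, be), c)) \in glue_index n).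
Proof.
rewrite !mem_pairs_dep !mem_iota /= !add0n; apply: (iffP idP).
  by case/andP => h /andP[/andP[-> ->] ->]; split=> //; lia.
by case=> -> -> -> h; rewrite !andbT; lia.
Qed.

Lemma W2_decomp n : perm_eq (W2 n)
  (iota 1 n :: [seq glue_tail x.2.1.1 x.2.1.2 x.2.2 x.1.1 | x <- glue_index n]).
Proof.
have good l p al be c : ((l, p), ((al, be), c)) \in glue_index n ->
    [/\ al \in Sn p, be \in Sn (n - l - 1 - p), c <= n - l - 1 - p, p = 0 -> c = 0
      & 0 < n - l - 1 - p].
  case/glue_indexP => /W2P[alS _] /W2P[beS _] /(heightsP _ alS beS)[cb pc _] ln.
  by split=> //; lia.
apply: uniq_perm; first exact: W2_uniq.
  rewrite /= map_inj_in_uniq; first (apply/andP; split).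
  - apply/mapP => -[[[l p] [[al be] c]] /[dup] /glue_indexP[_ _ _ ln]].
    move=> /good[alS beS cb pc b0] /= E.
    have := tl_glue_tail l alS beS cb pc b0; rewrite -E.
    have : n <= tl (iota 1 n) by rewrite leq_tl size_iota// subnn drop0.
    lia.
  - apply: uniq_pairs_dep => [|[l p] _].
      by apply: uniq_pairs_dep => [|? _]; apply: iota_uniq.
    apply: uniq_pairs_dep => [|[al be] _]; last first.
      by rewrite /heights; case: (al) => // *; apply: filter_uniq; apply: iota_uniq.
    by apply: uniq_pairs_dep => [|? _]; apply: W2_uniq.
  - move=> [[l p] [[al be] c]] [[l' p'] [[al' be'] c']] /good[alS beS cb pc b0].
    move=> /good[alS' beS' cb' pc' b0'] /= E.
    have [? ? ? ?] := glue_tail_inj alS beS cb pc b0 alS' beS' cb' pc' b0' E.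
    have [_ sal _] := SnP alS; have [_ sal' _] := SnP alS'.
    by subst.
move=> w; rewrite inE; have [->|wn] /= := eqVneq w (iota 1 n); first by rewrite iota_W2.
apply/idP/mapP => [wW|[[[l p] [[al be] c]] /[dup] /glue_indexP[alW beW ch ln] /good]].
  have [al [be [c [l [p [b [-> alW beW [lc cb pc b0 En]]]]]]]] := glue_tail_surj wW wn.
  exists ((l, p), ((al, be), c)) => //; apply/glue_indexP.
  have -> : n - l - 1 - p = b by lia.
  split=> //; last by lia.
  have [alS _] := W2P _ _ alW; have [beS _] := W2P _ _ beW.
  by apply/(heightsP _ alS beS).
case=> alS beS cb pc b0 ->; apply/W2P; have := glue_tail_Sn l alS beS cb pc.
have -> : p + (n - l - 1 - p) + 1 + l = n by lia.
split=> //=; apply/(avoids231_glue_tail l alS beS cb pc).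
have [_ avA] := W2P _ _ alW; have [_ avB] := W2P _ _ beW.
by split=> //; case/(heightsP _ alS beS): ch.
Qed.

(** * Generating functions *)

Local Open Scope ring_scope.

(** Both sides run over the pairs with [i + j + d < N]. *)
Lemma big_swap_tri (V : nmodType) (d N : nat) (f : nat -> nat -> V) :
  \sum_(0 <= j < N) \sum_(0 <= i < N - j - d) f i j =
  \sum_(0 <= i < N) \sum_(0 <= j < N - i - d) f i j.
Proof.
have E (g : nat -> nat -> V) : \sum_(0 <= j < N) \sum_(0 <= i < N - j - d) g i j =
    \sum_(0 <= j < N) \sum_(0 <= i < N | (i + j + d < N)%N) g i j.
  apply: eq_big_nat => j /andP[_ jN].
  rewrite (big_nat_widen _ _ N); last by lia.
  by apply: eq_bigl => i /=; lia.
rewrite E (E (fun j i => f i j)) (exchange_big_dep predT) //=.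
by apply: eq_bigr => i _; apply: eq_bigl => j; rewrite [(i + j)%N]addnC.
Qed.

(** The count is the rank of [c] from the top, and each rank occurs once. *)
Lemma big_count_geq (V : nmodType) (f : nat -> V) (s : seq nat) : sorted ltn s ->
  \sum_(c <- s) f (count (leq c) s) = \sum_(0 <= r < size s) f r.+1.
Proof.
elim: s => [|c s IH] /= ss; first by rewrite big_nil big_geq.
have := ss; rewrite (path_sortedE ltn_trans) => /andP[/allP cs ss'].
rewrite big_cons big_nat_recr//= addrC; congr (_ + _).
  rewrite -IH//; apply: eq_big_seq => c' /cs /= cc'.
  by rewrite leqNgt cc'.
congr f; rewrite leqnn add1n; congr _.+1; apply/eqP; rewrite -all_count.
by apply/allP => x /cs /= /ltnW.
Qed.

(** The exponent uses [leg] before the [i] entries are appended; their share [a ^+ i] is kept out so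
    that it can merge with [b ^+ i]. *)
Definition ext_sum (p i : nat) (a : K) : K :=
  \sum_(al <- W2 p) (fertility (al ++ iota p.+1 i))%:R * a ^+ (leg al - 1).

Lemma leg_iota n : leg (iota 1 n) = n.+1.
Proof. by rewrite -[iota 1 n]cat0s (@leg_add_tail 0 n [::])// addnC addn1. Qed.

Lemma tl_iota n : tl (iota 1 n) = n.
Proof.
apply/eqP; rewrite eqn_leq -{2}[n](size_iota 1) tl_leq /=.
by rewrite leq_tl size_iota// subnn drop0.
Qed.

Lemma W2_0 : W2 0 = [:: [::]]. Proof. by []. Qed.

Lemma ext_sum0 i a : ext_sum 0 i a = (catalan i)%:R.
Proof. by rewrite /ext_sum W2_0 big_seq1 mulr1. Qed.

Lemma W2_Sn n w : w \in W2 n -> w \in Sn n.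
Proof. by case/W2P. Qed.

Lemma JE a b n : (0 < n)%N -> J a b n =
  \sum_(w <- W2 n) (fertility w)%:R * a ^+ (leg w - 1) * b ^+ tl w.
Proof.
case: n => // n _; rewrite /J /=; apply: eq_big_seq => w /W2_Sn/npreimagesE.
by move=> ->.
Qed.

Lemma W2_tl_le n w : w \in W2 n -> (tl w <= n)%N.
Proof. by case/W2_Sn/SnP => _ <- _; apply: tl_leq. Qed.

(** Write [1 - b ^+ (tl w).+1] as [1 - b] times a geometric sum and exchange the sums: the
    permutations with [i <= tl w] arise by appending [i] entries, each adding one to [leg]. *)
Lemma sum_geometric_tl a b n : (0 < n)%N ->
  J a 1 n - b * J a b n =
  (1 - b) * \sum_(0 <= i < n.+1) (a * b) ^+ i * ext_sum (n - i) i a.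
Proof.
move=> n0; rewrite !JE// mulr_sumr -sumrB.
transitivity (\sum_(w <- W2 n) \sum_(0 <= i < n.+1 | (i <= tl w)%N)
    (1 - b) * ((fertility w)%:R * a ^+ (leg w - 1) * b ^+ i)).
  apply: eq_big_seq => w wW; rewrite expr1n mulr1.
  have -> : \sum_(0 <= i < n.+1 | (i <= tl w)%N)
      (1 - b) * ((fertility w)%:R * a ^+ (leg w - 1) * b ^+ i) =
      (fertility w)%:R * a ^+ (leg w - 1) * ((1 - b) * \sum_(0 <= i < (tl w).+1) b ^+ i).
    rewrite -mulr_sumr -mulr_sumr mulrCA; congr (_ * (_ * _)).
    by rewrite [RHS](big_nat_widen _ _ n.+1) ?ltnS ?W2_tl_le.
  have -> : (1 - b) * \sum_(0 <= i < (tl w).+1) b ^+ i = 1 - b * b ^+ tl w.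
    rewrite -exprS big_mkord -[1 - b]opprB mulNr -subrX1 opprB //.
  by rewrite mulrBr mulr1 mulrCA.
rewrite (exchange_big_dep predT) //= mulr_sumr; apply: eq_big_nat => i /andP[_]; rewrite ltnS => ni.
rewrite -big_filter (perm_big _ (W2_tl_geq ni)) big_map -mulr_sumr; congr (_ * _).
rewrite mulr_sumr; apply: eq_big_seq => al alW.
have [alS wav] := W2P _ _ alW; have := leg_count alS; have := leg_add_tail i alS.
move=> -> ->; rewrite addSn !subn1 /= exprD exprMn.
by ring.
Qed.

(** Sum of [a ^+ r] over the ranks [r] of the admissible heights. For [p = 0] only the lowest space
    0 is admissible, and its rank is [leg be]. *)
Definition glue_weight (a : K) (p : nat) (be : seq nat) : K :=
  if p == 0%N then a ^+ leg be else \sum_(0 <= r < leg be) a ^+ r.+1.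

Definition glue_sum (p b j : nat) (a : K) : K :=
  \sum_(be <- W2 b) (fertility (be ++ iota b.+1 j))%:R * glue_weight a p be.

Lemma sum_heights a p b al be l : al \in Sn p -> be \in Sn b -> (0 < b)%N ->
  \sum_(c <- heights al be) a ^+ (leg (glue_tail al be c l) - 1) =
  a ^+ l * a ^+ (leg al - 1) * glue_weight a p be.
Proof.
move=> alS beS b0; have [_ sal _] := SnP alS; have [_ sbe _] := SnP beS.
have -> : \sum_(c <- heights al be) a ^+ (leg (glue_tail al be c l) - 1) =
    a ^+ l * a ^+ (leg al - 1) * \sum_(c <- heights al be)
      a ^+ count (fun x => (c <= x)%N && legal_space be x) (iota 0 b.+1).
  rewrite mulr_sumr; apply: eq_big_seq => c /(heightsP _ alS beS)[cb pc _].
  rewrite (leg_glue_tail l alS beS cb pc) (leg_count alS) -!exprD.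
  by congr (_ ^+ _); lia.
congr (_ * _); rewrite /glue_weight /heights; case: al sal {alS} => [<-|x al <-] /=.
  by rewrite big_seq1 /leg sbe.
set s := [seq c <- iota 0 (size be).+1 | legal_space be c].
have -> : leg be = size s by rewrite /leg size_filter.
rewrite -(@big_count_geq _ (fun r => a ^+ r)).
  by apply: eq_bigr => c _; rewrite /s sbe count_filter.
by apply: sorted_filter; [exact: ltn_trans | exact: iota_ltn_sorted].
Qed.

Lemma J_glue a b n : J a b n.+1 = (catalan n.+1)%:R * (a * b) ^+ n.+1 +
  \sum_(0 <= l < n.+1) \sum_(0 <= p < n.+1 - l - 1) \sum_(0 <= j < l)
    (a * b) ^+ l * ext_sum p (l - j) a * glue_sum p (n.+1 - l - 1 - p) j a.
Proof.
rewrite JE// (perm_big _ (W2_decomp n.+1)) big_cons big_map leg_iota tl_iota subn1 /=.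
rewrite -mulrA -exprMn; congr (_ + _).
rewrite /glue_index big_allpairs_dep big_allpairs_dep /=.
rewrite -[0%N :: iota 1 n]/(index_iota 0 n.+1).
apply: eq_big_nat => l /andP[_ ln].
have -> m : iota 0 m = index_iota 0 m by rewrite /index_iota subn0.
apply: eq_big_nat => p /andP[_ pn].
rewrite big_allpairs_dep big_allpairs_dep /=.
set bb := (n.+1 - l - 1 - p)%N; have b0 : (0 < bb)%N by rewrite /bb; lia.
transitivity (\sum_(al <- W2 p) \sum_(be <- W2 bb) \sum_(0 <= j < l) (a * b) ^+ l *
    ((fertility (al ++ iota p.+1 (l - j)))%:R * a ^+ (leg al - 1)) *
    ((fertility (be ++ iota bb.+1 j))%:R * glue_weight a p be)).
  apply: eq_big_seq => al /W2_Sn alS; apply: eq_big_seq => be /W2_Sn beS.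
  transitivity ((\sum_(0 <= j < l) (fertility (al ++ iota p.+1 (l - j)))%:R *
      (fertility (be ++ iota bb.+1 j))%:R) * b ^+ l *
      \sum_(c <- heights al be) a ^+ (leg (glue_tail al be c l) - 1)).
    rewrite mulr_sumr; apply: eq_big_seq => c /(heightsP _ alS beS)[cb pc _].
    rewrite (fertility_glue_tail l alS beS cb pc b0) (tl_glue_tail l alS beS cb pc b0).
    rewrite natr_sum mulrAC; congr (_ * _ * _).
    by apply: eq_bigr => j _; rewrite natrM.
  rewrite (sum_heights _ _ alS beS b0) mulr_suml mulr_suml; apply: eq_bigr => j _.
  by rewrite exprMn; ring.
etransitivity; first by apply: eq_bigr => al _; apply: exchange_big.
rewrite exchange_big /=; apply: eq_bigr => j _.
rewrite /ext_sum /glue_sum -mulrA mulr_suml [RHS]mulr_sumr; apply: eq_bigr => al _.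
by rewrite [RHS]mulrA [RHS]mulr_sumr.
Qed.

(** The substitution [l = i + j + 1], [p = k - i] gives the left factor [k + 1] entries and the
    right one [n - k - 1], so the sum over [k] becomes a product of series in [t]. *)
Lemma J_rec a b n : J a b n.+1 = (catalan n.+1)%:R * (a * b) ^+ n.+1 +
  \sum_(0 <= k < n) \sum_(0 <= i < k.+1) \sum_(0 <= j < n - k - 1)
    (a * b) ^+ (i + j).+1 * ext_sum (k - i) i.+1 a * glue_sum (k - i) (n - k - 1 - j) j a.
Proof.
rewrite J_glue; congr (_ + _).
rewrite big_nat_recl// [X in X + _ = _]big1 ?add0r; last by move=> p _; rewrite big_geq.
transitivity (\sum_(0 <= l < n) \sum_(0 <= j < l.+1) \sum_(0 <= p < n - l - 1)
    (a * b) ^+ l.+1 * ext_sum p (l.+1 - j) a * glue_sum p (n - l - 1 - p) j a).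
  by apply: eq_bigr => l _; rewrite subSS exchange_big.
rewrite (big_triangle _ n (fun j l => \sum_(0 <= p < n - l - 1)
    (a * b) ^+ l.+1 * ext_sum p (l.+1 - j) a * glue_sum p (n - l - 1 - p) j a)).
rewrite (big_triangle _ n (fun i k => \sum_(0 <= j < n - k - 1) (a * b) ^+ (i + j).+1 *
    ext_sum (k - i) i.+1 a * glue_sum (k - i) (n - k - 1 - j) j a)) /=.
have S0 m : (m - 0 = m)%N by rewrite subn0.
under eq_bigr => j _ do rewrite -[(n - j)%N]S0.
rewrite big_swap_tri; apply: eq_bigr => i _; rewrite subn0.
transitivity (\sum_(0 <= j < n - i) \sum_(0 <= p < n - i - j - 1) (a * b) ^+ (i + j).+1 *
    ext_sum p i.+1 a * glue_sum p (n - i - j - 1 - p) j a).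
  apply: eq_bigr => j _; have -> : (n - (j + i) = n - i - j)%N by lia.
  apply: eq_bigr => p _; rewrite [(j + i)%N]addnC.
  by have -> : ((i + j).+1 - j = i.+1)%N by lia.
rewrite big_swap_tri; apply: eq_bigr => p _.
have -> : (n - (i + p) = n - i - p)%N by lia.
apply: eq_bigr => j _; rewrite [(i + p - i)%N]addKn.
by have -> : (n - i - j - 1 - p = n - i - p - 1 - j)%N by lia.
Qed.

(** * Auxiliary power series and their relations *)

Lemma natrS_neq0 n : (n.+1%:R : K) != 0.
Proof.
have -> : (n.+1%:R : K) = tofrac (n.+1%:R : Ruv) by rewrite rmorph_nat.
rewrite tofrac_eq0; have -> : (n.+1%:R : Ruv) = (n.+1%:R : {poly int})%:P by rewrite rmorph_nat.
rewrite polyC_eq0; have -> : (n.+1%:R : {poly int}) = (n.+1%:R : int)%:P by rewrite rmorph_nat.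
by rewrite polyC_eq0 Num.Theory.pnatr_eq0.
Qed.

Lemma Cm1E y m : (0 < m)%N -> Cm1 y m = (catalan m)%:R * y ^+ m.
Proof.
case: m => // m _; rewrite /Cm1 /=; congr (_ * _).
rewrite -catalanE natrM mulrAC mulfV ?mul1r//.
exact: natrS_neq0.
Qed.

Lemma J0 a b : J a b 0 = 0. Proof. by []. Qed.

Lemma Cm10 y : Cm1 y 0 = 0. Proof. by []. Qed.

(** Stopping before [j = m] leaves out the identities, which make up [Cm1]. *)
Definition tail_sum (a y : K) (m : nat) : K :=
  \sum_(0 <= j < m) y ^+ j * ext_sum (m - j) j a.

(** For positive [m], this is [tail_sum] without its term [j = 0], divided by [y]. *)
Definition shifted_tail_sum (a y : K) (m : nat) : K :=
  \sum_(0 <= i < m.-1) y ^+ i * ext_sum (m.-1 - i) i.+1 a.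

Definition height_sum (a y : K) (m : nat) : K :=
  \sum_(0 <= j < m) y ^+ j * \sum_(be <- W2 (m - j))
    (fertility (be ++ iota (m - j).+1 j))%:R * \sum_(0 <= r < leg be) a ^+ r.

Lemma J1E a m : (0 < m)%N -> J a 1 m = ext_sum m 0 a.
Proof.
move=> m0; rewrite JE//; apply: eq_bigr => w _.
by rewrite expr1n mulr1 cats0.
Qed.

Lemma tail_sumE a y m : tail_sum a y m = J a 1 m + y * shifted_tail_sum a y m.
Proof.
case: m => [|m]; first by rewrite /tail_sum /shifted_tail_sum !big_geq// mulr0 addr0.
rewrite /tail_sum big_nat_recl// expr0 mul1r subn0 J1E//; congr (_ + _).
by rewrite mulr_sumr; apply: eq_bigr => i _; rewrite mulrA -exprS.
Qed.

Lemma J_diff a b m : J a 1 m - b * J a b m =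
  (1 - b) * (tail_sum a (a * b) m + Cm1 (a * b) m).
Proof.
case: m => [|m].
  by rewrite /tail_sum (big_geq (leqnn 0)) !J0 Cm10; ring.
rewrite sum_geometric_tl// big_nat_recr//= subnn ext_sum0 Cm1E//.
by congr (_ * (_ + _)); rewrite mulrC.
Qed.

(** Telescoping leaves [1 - a ^+ leg be]; the constant 1 is the weight at [a = 1], with [y]
    unchanged. *)
Lemma height_sumE a y m :
  (1 - a) * height_sum a y m = tail_sum 1 y m - a * tail_sum a y m.
Proof.
rewrite /height_sum /tail_sum !mulr_sumr -sumrB; apply: eq_big_nat => j /andP[_ jm].
rewrite mulrCA [in RHS](mulrCA a) -mulrBr; congr (_ * _).
rewrite /ext_sum !mulr_sumr -sumrB; apply: eq_big_seq => be /W2_Sn beS.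
rewrite expr1n mulrCA mulr1 [in RHS](mulrCA a) -[X in _ = X - _]mulr1 -mulrBr.
congr (_ * _); rewrite (leg_count beS) subn1 /= -exprS.
by rewrite big_mkord -[1 - a]opprB mulNr -subrX1 opprB.
Qed.

(** The summands with [i = k] have an empty left block; their left factor counts preimages of an
    increasing word and gives [Cm1]. *)
Lemma J_recurrence a b n : J a b n.+1 = Cm1 (a * b) n.+1 +
  \sum_(0 <= k < n.+1)
    (a * b * shifted_tail_sum a (a * b) k * (a * height_sum a (a * b) (n - k)) +
     a * Cm1 (a * b) k * tail_sum a (a * b) (n - k)).
Proof.
rewrite J_rec Cm1E//; congr (_ + _).
(* Here [k] is the number of entries of the left factor, one more than in [J_rec]; the extra term
   [k = 0] vanishes. *)
rewrite [RHS]big_nat_recl// [X in _ = X + _](_ : _ = 0); last first.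
  by rewrite Cm10 /shifted_tail_sum big_geq// mulr0 !mul0r mulr0 mul0r addr0.
rewrite add0r; apply: eq_big_nat => k /andP[_ kn].
have -> : (n - k.+1 = n - k - 1)%N by lia.
set m := (n - k - 1)%N; rewrite big_nat_recr//= /shifted_tail_sum /=; congr (_ + _).
  rewrite mulr_sumr mulr_suml; apply: eq_big_nat => i /andP[_ ik].
  rewrite /height_sum [RHS]mulrA [RHS]mulr_sumr; apply: eq_bigr => j _.
  rewrite /glue_sum /glue_weight; have -> : (k - i == 0)%N = false by lia.
  rewrite exprS exprD.
  have -> : \sum_(be <- W2 (m - j)) (fertility (be ++ iota (m - j).+1 j))%:R *
      \sum_(0 <= r < leg be) a ^+ r.+1 = a * \sum_(be <- W2 (m - j))
      (fertility (be ++ iota (m - j).+1 j))%:R * \sum_(0 <= r < leg be) a ^+ r.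
    rewrite mulr_sumr; apply: eq_bigr => be _; rewrite mulrCA; congr (_ * _).
    by rewrite mulr_sumr; apply: eq_bigr => r _; rewrite exprS.
  ring.
rewrite subnn /tail_sum mulr_sumr; apply: eq_bigr => j _.
rewrite ext_sum0 Cm1E// /glue_sum /glue_weight eqxx.
have -> : \sum_(be <- W2 (m - j)) (fertility (be ++ iota (m - j).+1 j))%:R * a ^+ leg be =
    a * ext_sum (m - j) j a.
  rewrite /ext_sum mulr_sumr; apply: eq_big_seq => be /W2_Sn beS.
  by rewrite (leg_count beS) subn1 exprS /= mulrCA.
by rewrite -addSn exprD; ring.
Qed.

(** * Algebra of the functional equation *)

Lemma convolution_identity (F : fieldType) (a b : F) (n : nat)
    (J1 Jb J11 J1y C T S T1 H : nat -> F) :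
  1 - a != 0 -> 1 - b != 0 -> 1 - a * b != 0 -> b != 0 ->
  C 0%N = 0 ->
  (forall k, J1 k - b * Jb k = (1 - b) * (T k + C k)) ->
  (forall k, J11 k - a * b * J1y k = (1 - a * b) * (T1 k + C k)) ->
  (forall k, T k = J1 k + a * b * S k) ->
  (forall k, (1 - a) * H k = T1 k - a * T k) ->
  C n.+1 + \sum_(0 <= k < n.+1)
    (a * b * S k * (a * H (n - k)%N) + a * C k * T (n - k)%N) =
  \sum_(i < n.+2) C i * ((if (n.+1 - i == 0)%N then 1 else 0) +
     (if (n.+1 - i)%N is k.+1 then a * J1 k else 0)) +
  a * b / (1 - a) * \sum_(i < n.+1)
    (((1 - b)^-1 * (J1 i - Jb i) - b^-1 * C i) *
     ((1 - a * b)^-1 * (J11 (n - i)%N - a * b * J1y (n - i)%N) -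
      a / (1 - b) * (J1 (n - i)%N - b * Jb (n - i)%N))).
Proof.
move=> a1 b1 ab1 b0 C0 hJ hy hT hH.
have X k : (1 - b)^-1 * (J1 k - Jb k) - b^-1 * C k = a * S k.
  have E := hJ k; rewrite hT in E.
  have -> : Jb k = (J1 k - (1 - b) * (J1 k + a * b * S k + C k)) / b.
    by rewrite -E; field.
  by field; rewrite b0 b1.
(* The factor [1 - a] cancels the denominator of [a * b / (1 - a)]. *)
have Q k : (1 - a * b)^-1 * (J11 k - a * b * J1y k) - a / (1 - b) * (J1 k - b * Jb k) =
    (1 - a) * (H k + C k).
  rewrite hJ hy [RHS]mulrDr hH.
  by field; rewrite b1 ab1.
rewrite big_ord_recr /= subnn eqxx addr0 mulr1 -addrA addrCA; congr (_ + _).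
transitivity (\sum_(0 <= k < n.+1) (a * b * S k * (a * H (n - k)%N)) +
    \sum_(0 <= k < n.+1) (a * C k * J1 (n - k)%N) +
    \sum_(0 <= k < n.+1) (a * C k * (a * b * S (n - k)%N))).
  rewrite -!big_split /=; apply: eq_bigr => k _; rewrite hT; ring.
(* Reversing the convolution of [C] with [S] supplies the [C] that accompanies [H] in [Q]. *)
rewrite [X in _ + X = _]big_nat_rev /= add0n [_ + \sum_(0 <= k < n.+1) (a * C k * J1 _)]addrC.
rewrite -addrA -big_split /= mulr_sumr; congr (_ + _).
  rewrite big_mkord; apply: eq_bigr => i _; rewrite subSn ?leq_ord//=.
  by rewrite add0r; ring.
rewrite big_mkord; apply: eq_bigr => i _; rewrite X Q subSS subKn ?leq_ord//.
by field.
Qed.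

Lemma functional_equation (a b : K) : a != 1 -> b != 1 -> a * b != 1 -> b != 0 ->
  J a b =
  sadd
    (smul (Cm1 (a * b)) (sadd sone (stimes_t (sscale a (J a 1)))))
    (stimes_t
      (sscale (a * b / (1 - a))
        (smul
          (ssub (sscale (1 - b)^-1 (ssub (J a 1) (J a b)))
                (sscale b^-1 (Cm1 (a * b))))
          (ssub (sscale (1 - a * b)^-1 (ssub (J 1 1) (sscale (a * b) (J 1 (a * b)))))
                (sscale (a / (1 - b)) (ssub (J a 1) (sscale b (J a b)))))))).
Proof.
move=> a1 b1 ab1 b0; apply: functional_extensionality => -[|n].
  by rewrite /sadd /smul big_ord1 J0 Cm10 mul0r addr0.
rewrite [LHS]J_recurrence.
rewrite /sadd /stimes_t /smul /sscale /ssub.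
have sub_neq0 (x : K) : x != 1 -> 1 - x != 0 by rewrite subr_eq0 eq_sym.
(* Taking [J_diff] at [1] and [a * b] forgets [leg] but keeps the tail weight [a * b]. *)
have J_diff1 k : J 1 1 k - a * b * J 1 (a * b) k =
    (1 - a * b) * (tail_sum 1 (a * b) k + Cm1 (a * b) k) by rewrite J_diff mul1r.
exact: (@convolution_identity K a b n (J a 1) (J a b) (J 1 1) (J 1 (a * b)) (Cm1 (a * b))
  (tail_sum a (a * b)) (shifted_tail_sum a (a * b)) (tail_sum 1 (a * b))
  (height_sum a (a * b)) (sub_neq0 _ a1) (sub_neq0 _ b1) (sub_neq0 _ ab1) b0 (Cm10 _)
  (J_diff a b) J_diff1 (tail_sumE a (a * b)) (height_sumE a (a * b))).
Qed.

Lemma polyX_neq1 (R : nzRingType) : 'X != 1 :> {poly R}.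
Proof. by apply/eqP => /(congr1 (fun p : {poly R} => size p)); rewrite size_polyX size_poly1. Qed.

Lemma uK_neq1 : uK != 1.
Proof. by rewrite /uK -tofrac1 tofrac_eq -polyC1 (inj_eq polyC_inj) polyX_neq1. Qed.

Lemma vK_neq1 : vK != 1.
Proof. by rewrite /vK -tofrac1 tofrac_eq polyX_neq1. Qed.

Lemma vK_neq0 : vK != 0.
Proof. by rewrite /vK tofrac_eq0 polyX_eq0. Qed.

Lemma uvK_neq1 : uK * vK != 1.
Proof.
rewrite /uK /vK -tofracM -tofrac1 tofrac_eq mul_polyC.
apply/eqP => /(congr1 (fun p : Ruv => size p)).
by rewrite size_scale ?polyX_eq0// size_polyX size_poly1.
Qed.

Theorem theorem2p4 :
  let u := uK in let v := vK in
  J u v =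
  sadd
    (smul (Cm1 (u * v)) (sadd sone (stimes_t (sscale u (J u 1)))))
    (stimes_t
      (sscale (u * v / (1 - u))
        (smul
          (ssub (sscale (1 - v)^-1 (ssub (J u 1) (J u v)))
                (sscale v^-1 (Cm1 (u * v))))
          (ssub (sscale (1 - u * v)^-1 (ssub (J 1 1) (sscale (u * v) (J 1 (u * v)))))
                (sscale (u / (1 - v)) (ssub (J u 1) (sscale v (J u v)))))))).
Proof. exact: functional_equation uK_neq1 vK_neq1 uvK_neq1 vK_neq0. Qed.
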